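(* Let $G=\mathbb{Z}_2$. If $\beta>0$ is sufficiently large and $\kappa>0$ is sufficiently small (i.e. there are $\beta_*,\kappa_*>0$, depending only on $m$, such that the following holds for all $\beta>\beta_*$ and $0<\kappa<\kappa_*$), then for all strictly increasing sequences $(R_n)_{n\ge1}$ and $(T_n)_{n\ge1}$ of positive integers, with $\gamma_1^{(n)},\gamma_2^{(n)}$ the two halves of the $2R_n\times T_n$ rectangular loop $\gamma^{(n)}=\gamma_1^{(n)}+\gamma_2^{(n)}$ described in the context and $$\rho(\gamma_1^{(n)},\gamma_2^{(n)})=\frac{\langle W_{\gamma_1^{(n)}}(\sigma,\phi)\rangle_{\beta,\kappa}\,\langle W_{\gamma_2^{(n)}}(\sigma,\phi)\rangle_{\beta,\kappa}}{\langle W_{\gamma^{(n)}}(\sigma)\rangle_{\beta,\kappa}},$$ one has: (i) The limit $\rho=\rho_{\beta,\kappa}:=\lim_{n\to\infty}\rho(\gamma_1^{(n)},\gamma_2^{(n)})$ exists and is independent of $(R_n)_{n\ge1}$ and $(T_n)_{n\ge1}$. (ii) The limit is zero, i.e. $\rho=0$.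
   Context: **Lattice and forms.** Fix $m\ge3$ and let $B_N=[-N,N]^m\cap\mathbb{Z}^m$. $C_0(B_N),C_1(B_N),C_2(B_N)$ are the sets of oriented vertices, nearest-neighbour edges and plaquettes ($2$-cells) with all endpoints in $B_N$ (both orientations). $\Omega^k(B_N,\mathbb{Z}_2)$ is the set of functions $\omega:C_k(B_N)\to\mathbb{Z}_2$ with $\omega(-c)=-\omega(c)$. For $\sigma\in\Omega^1(B_N,\mathbb{Z}_2)$ and a plaquette $p$, $d\sigma(p)=\sum_{e\in\partial p}\sigma(e)$; for $\phi\in\Omega^0(B_N,\mathbb{Z}_2)$ and an edge $e$ from $x_1$ to $x_2$, $\phi(\partial e)=\phi(x_2)-\phi(x_1)$. **Model.** The lattice Higgs model with structure group $\mathbb{Z}_2$ (representation $g\mapsto(-1)^g$) is the probability measure on $\Omega^1(B_N,\mathbb{Z}_2)\times\Omega^0(B_N,\mathbb{Z}_2)$ with $$\mu_{N,\beta,\kappa}(\sigma,\phi)\propto\exp\Bigl(\beta\sum_{p\in C_2(B_N)}(-1)^{d\sigma(p)}+\kappa\sum_{e\in C_1(B_N)}(-1)^{\sigma(e)-\phi(\partial e)}\Bigr),$$ with expectation $\mathbb{E}_{N,\beta,\kappa}$, and $\langle f\rangle_{\beta,\kappa}=\lim_{N\to\infty}\mathbb{E}_{N,\beta,\kappa}[f]$ for $f$ depending on finitely many spins (this limit exists and is translation invariant). A path is a finitely supported $1$-chain $\gamma$ (formal integer combination of positively oriented edges) with coefficients in $\{-1,0,1\}$; it is a loop if $\partial\gamma=0$.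 The Wilson line observable is $W_\gamma(\sigma,\phi)=(-1)^{\sigma(\gamma)-\phi(\partial\gamma)}$; for a loop it does not depend on $\phi$ and is written $W_\gamma(\sigma)$. **The paths.** $\gamma^{(n)}$ is the (counterclockwise oriented) boundary of an axis-parallel rectangle in a coordinate plane with corners $(0,0),(T_n,0),(T_n,2R_n),(0,2R_n)$. $\gamma_1^{(n)}$ is the part of it going from $(0,R_n)$ via $(0,0)$ and $(T_n,0)$ to $(T_n,R_n)$, and $\gamma_2^{(n)}=\gamma^{(n)}-\gamma_1^{(n)}$. *)

(* Defs.v *)
From HB Require Import structures.
From mathcomp Require Import all_boot all_order all_algebra.
From mathcomp Require Import finmap freeg.
From mathcomp Require Import all_classical all_reals all_analysis.

Set Implicit Arguments.
Unset Strict Implicit.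
Unset Printing Implicit Defensive.

Import Order.TTheory GRing.Theory Num.Theory.
Import numFieldNormedType.Exports.

Local Open Scope classical_set_scope.
Local Open Scope ring_scope.

(* A positive cell c yields two oriented cells, (false, c) = c and
   (true, c) = -c. *)
Definition oriented (T : Type) : Type := (bool * T)%type.
Definition opp (T : Type) (c : oriented T) : oriented T := (~~ c.1, c.2).

Section Cells.
Variable m : nat.

Definition vertex := 'rV[int]_m.
(* (x, i) is the positively oriented edge from x to x + e_i. *)
Definition edge := (vertex * 'I_m)%type.
(* For i != j, (x, i, j) is the oriented unit square at x whose boundary leaves
   x in direction i; its opposite is (x, j, i), so both orientations occur. *)
Definition plaquette := (edge * 'I_m)%type.

Definition unit_vec (i : 'I_m) : vertex := delta_mx 0 i.

Definition esrc (e : oriented edge) : vertex :=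
  if e.1 then e.2.1 + unit_vec e.2.2 else e.2.1.
Definition etgt (e : oriented edge) : vertex :=
  if e.1 then e.2.1 else e.2.1 + unit_vec e.2.2.

Definition corners (p : plaquette) : seq vertex :=
  let: (x, i, j) := p in
  [:: x; x + unit_vec i; x + unit_vec i + unit_vec j; x + unit_vec j].

Definition plaquette_boundary (p : plaquette) : seq (oriented edge) :=
  let: (x, i, j) := p in
  [:: (false, (x, i)); (false, (x + unit_vec i, j));
      (true, (x + unit_vec j, i)); (true, (x, j))].

(* [-N, N]^m as a translate of {0, ..., 2N}^m; see [mem_box]. *)
Definition box (N : nat) : {fset vertex} :=
  [fset (\row_i ((f i : nat)%:Z - N%:Z) : vertex)
    | f : {ffun 'I_m -> 'I_(N.*2.+1)} in {: {ffun 'I_m -> 'I_(N.*2.+1)}}]%fset.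

Lemma mem_box (N : nat) (x : vertex) :
  (x \in box N) = [forall i, `|x 0 i| <= N%:Z].
Proof.
apply/imfsetP/forallP => [[f _ ->] i|hx].
  rewrite mxE ler_norml; have := ltn_ord (f i); rewrite ltnS -lez_nat => h.
  rewrite lerBlDr lerBrDr addNr lez_nat /=.
  by apply: le_trans h _; rewrite -addnn PoszD.
have x_ge i : 0 <= x 0 i + N%:Z.
  by have := hx i; rewrite ler_norml -(lerD2r N%:Z) addNr => /andP[].
have hi i : (absz (x 0 i + N%:Z)%R < N.*2.+1)%N.
  have := hx i; rewrite ler_norml => /andP[_ h2].
  by rewrite ltnS -lez_nat gez0_abs // -addnn PoszD lerD2r.
exists [ffun i : 'I_m => Ordinal (hi i)]; first by rewrite !inE.
by apply/rowP => i; rewrite mxE ffunE /= gez0_abs ?addrK.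
Qed.

Definition C0 (N : nat) : {fset oriented vertex} :=
  [fset ((b, x) : oriented vertex) | b : bool, x in box N]%fset.

Definition edges_from (N : nat) : {fset edge} :=
  [fset ((x, i) : edge) | x in box N, i : 'I_m]%fset.

Definition C1 (N : nat) : {fset oriented edge} :=
  [fset e in [fset ((b, e) : oriented edge) | b : bool, e in edges_from N]
   | (esrc e \in box N) && (etgt e \in box N)]%fset.

Definition C2 (N : nat) : {fset plaquette} :=
  [fset p in [fset ((e, j) : plaquette) | e in edges_from N, j : 'I_m]
   | (p.1.2 != p.2) && all (mem (box N)) (corners p)]%fset.

Lemma mem_C0 (N : nat) (c : oriented vertex) : (c \in C0 N) = (c.2 \in box N).
Proof.
apply/imfset2P/idP => [[b _ [x hx ->]]|hc] //.
by exists c.1 => //; exists c.2 => //; case: c {hc}.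
Qed.

Lemma mem_edges_from (N : nat) (e : edge) :
  (e \in edges_from N) = (e.1 \in box N).
Proof.
apply/imfset2P/idP => [[x hx [i _ ->]]|he] //.
by exists e.1 => //; exists e.2 => //; case: e {he}.
Qed.

Lemma mem_C1 (N : nat) (e : oriented edge) :
  (e \in C1 N) = (esrc e \in box N) && (etgt e \in box N).
Proof.
rewrite !inE /= andb_idl // => /andP[h1 h2].
apply/imfset2P; exists e.1 => //; exists e.2; last by case: e {h1 h2}.
  rewrite mem_edges_from; move: h1 h2; rewrite /esrc /etgt.
by case: e.1.
Qed.

Lemma mem_C2 (N : nat) (p : plaquette) :
  (p \in C2 N) = (p.1.2 != p.2) && all (mem (box N)) (corners p).
Proof.
rewrite !inE /= andb_idl // => /andP[_].
case: p => [[x i] j] /= /andP[hx _].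
apply/imfset2P; exists (x, i); first by rewrite mem_edges_from.
by exists j.
Qed.

End Cells.

Section Forms.
Variables (T : choiceType) (A : {fset oriented T}).

(* Extension by 0 outside A. *)
Definition ext (w : {ffun A -> 'Z_2}) (c : oriented T) : 'Z_2 :=
  if insub c is Some c' then w c' else 0.

Definition form (w : {ffun A -> 'Z_2}) : bool :=
  [forall c : A, ext w (opp (val c)) == - w c].

End Forms.

Section Model.
Variables (R : realType) (m : nat).
Local Notation Edge := (edge m).
Local Notation Vertex := (vertex m).

Definition repr_Z2 (g : 'Z_2) : R := (-1) ^+ g.

Definition d1 (s : oriented Edge -> 'Z_2) (p : plaquette m) : 'Z_2 :=
  \sum_(e <- plaquette_boundary p) s e.

Definition d0 (phi : oriented Vertex -> 'Z_2) (e : oriented Edge) : 'Z_2 :=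
  phi (false, etgt e) - phi (false, esrc e).

Section Gibbs.
Variables (beta kappa : R) (N : nat).

Definition Omega1 := [pred w : {ffun C1 m N -> 'Z_2} | form w].
Definition Omega0 := [pred w : {ffun C0 m N -> 'Z_2} | form w].

Definition gibbs_weight (s : {ffun C1 m N -> 'Z_2})
    (phi : {ffun C0 m N -> 'Z_2}) : R :=
  expR (beta * (\sum_(p <- C2 m N) repr_Z2 (d1 (ext s) p))
        + kappa * (\sum_(e <- C1 m N) repr_Z2 (ext s e - d0 (ext phi) e))).

Definition partition_function : R :=
  \sum_(s in Omega1) \sum_(phi in Omega0) gibbs_weight s phi.

Definition mu (s : {ffun C1 m N -> 'Z_2}) (phi : {ffun C0 m N -> 'Z_2}) : R :=
  gibbs_weight s phi / partition_function.

(* Observables are functions of cochains on the whole lattice; one depending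
   on finitely many spins only sees spins of B_N once N is large. *)
Definition expectation
    (f : (oriented Edge -> 'Z_2) -> (oriented Vertex -> 'Z_2) -> R) : R :=
  \sum_(s in Omega1) \sum_(phi in Omega0) f (ext s) (ext phi) * mu s phi.

End Gibbs.

Definition mean (beta kappa : R)
    (f : (oriented Edge -> 'Z_2) -> (oriented Vertex -> 'Z_2) -> R) : R :=
  lim ((fun N => expectation beta kappa N f) @ \oo).

(* Finitely supported chains: formal Z-combinations of positive cells. *)
Definition eval_chain (T : choiceType) (w : oriented T -> 'Z_2)
    (c : {freeg T / int}) : 'Z_2 :=
  \sum_(x <- dom c) w (false, x) *~ coeff x c.

Definition boundary (c : {freeg Edge / int}) : {freeg Vertex / int} :=
  \sum_(e <- dom c) coeff e c *: (<< etgt (false, e) >> - << esrc (false, e) >>).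

Definition wilson (c : {freeg Edge / int}) (s : oriented Edge -> 'Z_2)
    (phi : oriented Vertex -> 'Z_2) : R :=
  repr_Z2 (eval_chain s c - eval_chain phi (boundary c)).

Definition rho_ratio (beta kappa : R) (c1 c2 : {freeg Edge / int}) : R :=
  mean beta kappa (wilson c1) * mean beta kappa (wilson c2)
  / mean beta kappa (wilson (c1 + c2)).

End Model.

Section Rectangle.
Variables (m : nat) (i j : 'I_m).

(* The straight path from x to x + n e_k. *)
Definition segment (x : vertex m) (k : 'I_m) (n : nat) : {freeg (edge m) / int} :=
  \sum_(l < n) << (x + unit_vec k *+ l, k) >>.

Definition rectangle (T L : nat) : {freeg (edge m) / int} :=
  segment 0 i T + segment (unit_vec i *+ T) j L
  - segment (unit_vec j *+ L) i T - segment 0 j L.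

Definition gamma1 (T r : nat) : {freeg (edge m) / int} :=
  - segment 0 j r + segment 0 i T + segment (unit_vec i *+ T) j r.

Definition gamma2 (T r : nat) : {freeg (edge m) / int} :=
  rectangle T r.*2 - gamma1 T r.

End Rectangle.

(* Main.v *)
(* Gauge-invariant observables are characters of the finite group of
   configurations, so Griffiths' inequalities hold: <AB> >= <A><B>, and averages
   increase with the couplings.

   Expanding the factors exp(kappa W_e) at the edges e of a vertex z gives
   <A> <= 2 tanh(kappa) sum_e <A W_e> for every A that is odd at z.  Iterating
   this from the endpoint x of the open line g1 gives walks from x to the other
   endpoint y, and likewise for g2.  For such walks w1, w2 the line w1 + w2 is
   closed, and Griffiths gives
     <g1 w1><g2 w2> <= <g1 g2 w1 w2> <= <g1 g2> / <w1 w2>.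
   Hence a lower bound <w> >= 2^-|w| for closed lines suffices: the ratio is then
   at most the square of a sum over walks of length at least T of
   (O(m) tanh kappa)^length.

   For the lower bound drop the factors of the edges, and replace the plaquette factors at each
   site, independently, by projectors onto flat configurations (with probability
   close to 1) or by nothing; this only lowers averages.  A closed line has
   average 1 when no cluster of bad sites is large compared with its distance to
   the line: such a cluster carries a compactly supported closed 2-cochain, which
   bounds a 1-cochain supported near the cluster when m >= 3, so the gauge field
   is a pure gauge along the line.  By Harris' inequality this has probability at
   least 2^-|w|. *)
From HB Require Import structures.
Require Import Defs.
From mathcomp Require Import all_boot all_order all_algebra.
From mathcomp Require Import finmap freeg.
From mathcomp Require Import all_classical all_reals all_analysis.
From mathcomp Require Import ring lra zify.
Import Order.TTheory GRing.Theory Num.Theory.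
Import numFieldNormedType.Exports.
Local Open Scope classical_set_scope.
Local Open Scope ring_scope.
Set Implicit Arguments.
Unset Strict Implicit.
Unset Printing Implicit Defensive.

(** * Griffiths inequalities for finite groups of exponent two *)

Section CharTwo.
Variables (R : realFieldType) (V : finZmodType) (G : {pred V}).
Hypothesis addVV : forall x : V, x + x = 0.
Hypothesis G0 : 0 \in G.
Hypothesis GD : forall x y, x \in G -> y \in G -> x + y \in G.
Implicit Types (f w chi : V -> R) (a b : R).

Definition character chi := chi 0 = 1 /\ forall x y, chi (x + y) = chi x * chi y.

Definition gsum f : R := \sum_(c in G) f c.

Lemma character_sqr chi x : character chi -> chi x * chi x = 1.
Proof. by case=> chi0 chiD; rewrite -chiD addVV. Qed.

Lemma character_pm chi x : character chi -> chi x = 1 \/ chi x = -1.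
Proof.
move=> hchi; have /eqP := character_sqr x hchi.
by rewrite -expr2 sqrf_eq1 => /orP[] /eqP ->; [left|right].
Qed.

Lemma characterM chi psi :
  character chi -> character psi -> character (fun c => chi c * psi c).
Proof.
move=> [chi0 chiD] [psi0 psiD]; split=> [|x y]; first by rewrite chi0 psi0 mulr1.
by rewrite chiD psiD mulrACA.
Qed.

Lemma gsum_shift f u : u \in G -> gsum f = gsum (fun c => f (c + u)).
Proof.
move=> uG; rewrite /gsum.
have uK : involutive (fun c : V => c + u) by move=> c; rewrite -addrA addVV addr0.
rewrite (reindex_inj (inv_inj uK)) /=; apply: eq_bigl => c.
by apply/idP/idP => [cG|/GD]; [rewrite -(uK c) GD|apply].
Qed.

Lemma eq_gsum f f' : (forall c, c \in G -> f c = f' c) -> gsum f = gsum f'.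
Proof. by move=> h; apply: eq_bigr. Qed.

Lemma gsumD f f' : gsum (fun c => f c + f' c) = gsum f + gsum f'.
Proof. exact: big_split. Qed.

Lemma gsumZ a f : gsum (fun c => a * f c) = a * gsum f.
Proof. by rewrite /gsum mulr_sumr. Qed.

Lemma gsum_odd f u : u \in G -> (forall c, f (c + u) = - f c) -> gsum f = 0.
Proof.
move=> uG fN; have /eqP := gsum_shift f uG.
rewrite [X in _ == X](eq_gsum (f' := fun c => - 1 * f c)); last first.
  by move=> c _; rewrite fN mulN1r.
by rewrite gsumZ mulN1r -subr_eq0 opprK -mulr2n mulrn_eq0 /= => /eqP.
Qed.

(** All Fourier coefficients of the weight over [G] are nonnegative. For a Gibbs weight this is the
    first Griffiths inequality before normalization. *)
Definition positive_type f := forall chi, character chi -> 0 <= gsum (fun c => f c * chi c).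

(** Orthogonality: if [chi u = -1] for some [u] in [G], the sum vanishes; otherwise [chi] is 1 on
    all of [G]. *)
Lemma positive_type1 : positive_type (fun=> 1).
Proof.
move=> chi hchi; have [/existsP[u /andP[uG /eqP chiu]]|] := boolP [exists u in G, chi u == -1].
  rewrite (@gsum_odd _ u) // => c.
  by case: hchi => _ ->; rewrite chiu mulrN1 mulrN.
move=> /existsPn h; apply: sumr_ge0 => c cG; rewrite mul1r.
have := h c; rewrite cG /=; case: (character_pm c hchi) => ->; rewrite ?ler01 //.
by rewrite eqxx.
Qed.

Lemma positive_type_factor f a b chi : 0 <= a -> 0 <= b -> character chi ->
  positive_type f -> positive_type (fun c => f c * (a + b * chi c)).
Proof.
move=> a0 b0 hchi hf psi hpsi.
rewrite (eq_gsum (f' := fun c => a * (f c * psi c) + b * (f c * (chi c * psi c)))).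
  rewrite gsumD !gsumZ addr_ge0 ?mulr_ge0 ?hf //; exact: characterM.
by move=> c _; ring.
Qed.

(* The last clause is what the duplicated system [(c, c + u)] of Ginibre's
   proof of the second Griffiths inequality requires. *)
Definition ferromagnetic w := [/\ 0 < gsum w, positive_type w &
  forall u, u \in G -> positive_type (fun c => w c * w (c + u))].

Lemma ferromagnetic1 : ferromagnetic (fun=> 1).
Proof.
split; last by move=> u _ chi hchi; rewrite mul1r; exact: positive_type1.
  by rewrite /gsum (bigD1 0) //= ltr_wpDr // sumr_ge0.
exact: positive_type1.
Qed.

Lemma ferromagnetic_factor w a b chi : 0 < a -> 0 <= b <= a -> character chi ->
  ferromagnetic w -> ferromagnetic (fun c => w c * (a + b * chi c)).
Proof.
move=> a0 /andP[b0 ba] hchi [w0 wP wwP]; split.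
- rewrite (eq_gsum (f' := fun c => a * w c + b * (w c * chi c))).
    by rewrite gsumD !gsumZ ltr_pwDl ?mulr_gt0 // mulr_ge0 ?wP.
  by move=> c _; ring.
- by apply: positive_type_factor => //; exact: ltW.
move=> u uG psi hpsi.
have hu := character_sqr _ hchi.
(* Since [chi] squares to 1, the factors at [c] and [c + u] multiply to [A + B * chi c]. The bound
   [b <= a] keeps [A] nonnegative when [chi u = -1]. *)
set A := a ^+ 2 + b ^+ 2 * chi u; set B := a * b * (1 + chi u).
have A0 : 0 <= A.
  by rewrite /A; case: (character_pm u hchi) => ->; nra.
have B0 : 0 <= B.
  by rewrite /B !mulr_ge0 ?(ltW a0) //; case: (character_pm u hchi) => ->; lra.
have := positive_type_factor A0 B0 hchi (wwP u uG) hpsi.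
rewrite (eq_gsum (f' := fun c => w c * (a + b * chi c) * (w (c + u) *
    (a + b * chi (c + u))) * psi c)) // => c _.
case: (hchi) => _ ->; rewrite /A /B.
have -> : w c * w (c + u) * (a ^+ 2 + b ^+ 2 * chi u + a * b * (1 + chi u) * chi c) =
   w c * w (c + u) * (a ^+ 2 + b ^+ 2 * chi u * (chi c * chi c)
      + a * b * (1 + chi u) * chi c) by rewrite hu mulr1.
by ring.
Qed.

Lemma eq_ferromagnetic w w' : w =1 w' -> ferromagnetic w -> ferromagnetic w'.
Proof. by move=> /funext ->. Qed.

Definition avg w f : R := gsum (fun c => f c * w c) / gsum w.

Lemma avg_ge0 w chi : ferromagnetic w -> character chi -> 0 <= avg w chi.
Proof.
move=> [w0 wP _] hchi; rewrite divr_ge0 ?(ltW w0) //.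
by rewrite (eq_gsum (f' := fun c => w c * chi c)) ?wP // => c _; rewrite mulrC.
Qed.

Lemma eq_avg w f f' : (forall c, c \in G -> f c = f' c) -> avg w f = avg w f'.
Proof. by move=> h; rewrite /avg (eq_gsum (f' := fun c => f' c * w c)) // => c /h ->. Qed.

Lemma avgK w f : ferromagnetic w -> avg w f * gsum w = gsum (fun c => f c * w c).
Proof. by case=> w0 _ _; rewrite /avg mulfVK ?gt_eqF. Qed.

(** Ginibre's duplication: with the second copy written as [c + u], the covariance times the square
    of [gsum w] is a sum over [u] of [1 - psi u] times a Fourier coefficient of [w c * w (c + u)],
    and both are nonnegative. *)
Lemma griffiths2 w chi psi : ferromagnetic w -> character chi -> character psi ->
  avg w chi * avg w psi <= avg w (fun c => chi c * psi c).
Proof.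
move=> [w0 wP wwP] hchi hpsi; rewrite /avg mulf_div ler_pdivrMr ?mulr_gt0 //.
rewrite mulrA mulfVK ?gt_eqF // -subr_ge0.
set S := gsum w.
pose D u := gsum (fun c => chi c * psi c * w c * w (c + u)
                           - chi c * w c * (psi (c + u) * w (c + u))).
have D_ge0 u : u \in G -> 0 <= D u.
  move=> uG; have := wwP u uG _ (characterM hchi hpsi).
  have -> : D u = (1 - psi u) * gsum (fun c => w c * w (c + u) * (chi c * psi c)).
    rewrite -gsumZ; apply: eq_gsum => c _; case: (hpsi) => _ ->.
    by ring.
  move=> h; rewrite mulr_ge0 //.
  by case: (character_pm u hpsi) => ->; lra.
suff <- : \sum_(u in G) D u = gsum (fun c => chi c * psi c * w c) * S
    - gsum (fun c => chi c * w c) * gsum (fun c => psi c * w c).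
  by apply: sumr_ge0.
rewrite /D /gsum exchange_big /= !big_distrl /= -sumrB; apply: eq_bigr => c cG.
rewrite sumrB -!mulr_sumr; congr (_ * _ - _ * _).
  by rewrite /S (gsum_shift w cG); apply: eq_bigr => u _; rewrite addrC.
rewrite -[RHS]/(gsum (fun c => psi c * w c)) (gsum_shift _ cG) /gsum.
by apply: eq_bigr => u _; rewrite addrC.
Qed.

(** The new average is (a <psi> + b <chi psi>) / (a + b <chi>), so the claim reduces to the second
    Griffiths inequality. *)
Lemma avg_factor w a b chi psi : 0 < a -> 0 <= b <= a ->
  ferromagnetic w -> character chi -> character psi ->
  avg w psi <= avg (fun c => w c * (a + b * chi c)) psi.
Proof.
move=> a0 hba hw hchi hpsi; have h2 := griffiths2 hw hchi hpsi.
have [wf0 _ _] := ferromagnetic_factor a0 hba hchi hw; case/andP: hba => b0 ba.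
case: (hw) => w0 wP _; rewrite /avg ler_pdivlMr //.
have -> : gsum (fun c => w c * (a + b * chi c)) = (a + b * avg w chi) * gsum w.
  rewrite mulrDl -[b * _ * _]mulrA avgK // -!gsumZ -gsumD; apply: eq_gsum => c _.
  by ring.
have -> : gsum (fun c => psi c * (w c * (a + b * chi c))) =
   (a * avg w psi + b * avg w (fun c => chi c * psi c)) * gsum w.
  rewrite mulrDl -[a * _ * _]mulrA -[b * _ * _]mulrA !avgK // -!gsumZ -gsumD; apply: eq_gsum => c _.
  by ring.
rewrite -/(avg w psi) mulrA ler_pM2r //; nra.
Qed.

(* Turning a factor [a + b chi] into the projector [1 + chi] (infinite coupling)
   with probability [b / a], and removing it otherwise, only lowers averages. *)
Lemma avg_mixture w a b chi psi : 0 < a -> 0 <= b <= a ->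
  ferromagnetic w -> character chi -> character psi ->
  (1 - b / a) * avg w psi + b / a * avg (fun c => w c * (1 + chi c)) psi
    <= avg (fun c => w c * (a + b * chi c)) psi.
Proof.
move=> a0 hba hw hchi hpsi.
have h11 : 0 <= (1 : R) <= (1 : R) by rewrite ler01 lexx.
have e1 : (fun c => w c * (1 + 1 * chi c)) = (fun c => w c * (1 + chi c)).
  by apply/funext => c; rewrite mul1r.
have hm := avg_factor ltr01 h11 hw hchi hpsi; rewrite e1 in hm.
have [] := ferromagnetic_factor ltr01 h11 hchi hw; rewrite e1 => v0 _ _.
have [f0 _ _] := ferromagnetic_factor a0 hba hchi hw; case/andP: hba => b0 ba.
case: (hw) => w0 wP _.
(* The factor splits as (a - b) + b (1 + chi): no coupling plus a multiple of the projector. *)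
have eqf h : gsum (fun c => h c * (w c * (a + b * chi c))) =
   (a - b) * gsum (fun c => h c * w c) + b * gsum (fun c => h c * (w c * (1 + chi c))).
  by rewrite -!gsumZ -gsumD; apply: eq_gsum => c _; ring.
have eqf1 : gsum (fun c => w c * (a + b * chi c)) =
   (a - b) * gsum w + b * gsum (fun c => w c * (1 + chi c)).
  by rewrite -!gsumZ -gsumD; apply: eq_gsum => c _; ring.
have ge : gsum w <= gsum (fun c => w c * (1 + chi c)).
  rewrite [leRHS](eq_gsum (f' := fun c => w c + w c * chi c)).
    by rewrite gsumD lerDl wP.
  by move=> c _; ring.
rewrite [in leRHS]/avg ler_pdivlMr //= eqf eqf1.
move: w0 v0 f0 ge hm; rewrite eqf1 /avg.
set W := gsum w; set X := gsum (fun c => w c * (1 + chi c)).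
set P := gsum (fun c => psi c * w c).
set Q := gsum (fun c => psi c * (w c * (1 + chi c))).
move=> W0 X0 F0 WX PQ.
have -> : P = P / W * W by rewrite mulfVK ?gt_eqF.
have -> : Q = Q / X * X by rewrite mulfVK ?gt_eqF.
move: PQ; move: (P / W) (Q / X) => p q.
rewrite !mulfK ?gt_eqF // => pq.
have -> : b = b / a * a by rewrite mulfVK ?gt_eqF.
have : 0 <= b / a <= 1 by rewrite divr_ge0 ?(ltW a0) // ler_pdivrMr ?mul1r.
move: (b / a) => r /andP[r0 r1]; rewrite mulfK ?gt_eqF //.
(* The two sides differ by a r (1 - r) (q - p) (X - W). The projector raises the average, so
   [p <= q], and the total weight, so [W <= X]. *)
rewrite -subr_ge0.
have -> : (a - r * a) * (p * W) + r * a * (q * X) -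
   ((1 - r) * p + r * q) * ((a - r * a) * W + r * a * X) =
   a * (r * (1 - r) * (q - p) * (X - W)) by ring.
by rewrite !mulr_ge0 ?subr_ge0 ?(ltW a0).
Qed.

(** * Products of factors [a + b * chi] *)

Section Products.
Variables (I : Type).
Implicit Types (s : seq I).

Lemma ferromagnetic_prod (a b : I -> R) (chi : I -> V -> R) s w :
  (forall k, 0 < a k) -> (forall k, 0 <= b k <= a k) ->
  (forall k, character (chi k)) -> ferromagnetic w ->
  ferromagnetic (fun c => w c * \prod_(k <- s) (a k + b k * chi k c)).
Proof.
move=> a0 b0 hchi; elim: s w => [|k s IHs] w hw.
  by apply: eq_ferromagnetic hw => c; rewrite big_nil mulr1.
have := IHs _ (ferromagnetic_factor (a0 k) (b0 k) (hchi k) hw).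
by apply: eq_ferromagnetic => c; rewrite big_cons mulrA.
Qed.

Lemma avg_prod (a b : I -> R) (chi : I -> V -> R) s w psi :
  (forall k, 0 < a k) -> (forall k, 0 <= b k <= a k) ->
  (forall k, character (chi k)) -> ferromagnetic w -> character psi ->
  avg w psi <= avg (fun c => w c * \prod_(k <- s) (a k + b k * chi k c)) psi.
Proof.
move=> a0 b0 hchi + hpsi; elim: s w => [|k s IHs] w hw.
  have -> // : (fun c => w c * \prod_(k <- [::]) (a k + b k * chi k c)) = w.
  by apply/funext => c; rewrite big_nil mulr1.
have -> : (fun c => w c * \prod_(j <- k :: s) (a j + b j * chi j c)) =
    (fun c => w c * (a k + b k * chi k c) * \prod_(j <- s) (a j + b j * chi j c)).
  by apply/funext => c; rewrite big_cons mulrA.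
apply: le_trans (IHs _ (ferromagnetic_factor (a0 k) (b0 k) (hchi k) hw)).
exact: avg_factor.
Qed.

Lemma positive_type_prod (a b : I -> R) (chi : I -> V -> R) s f :
  (forall k, 0 <= a k) -> (forall k, 0 <= b k) ->
  (forall k, character (chi k)) -> positive_type f ->
  positive_type (fun c => f c * \prod_(k <- s) (a k + b k * chi k c)).
Proof.
move=> a0 b0 hchi; elim: s f => [|k s IHs] f hf psi hpsi.
  by under eq_gsum => c _ do rewrite big_nil mulr1; exact: hf.
under eq_gsum => c _ do rewrite big_cons mulrA.
by apply: IHs hpsi; exact: positive_type_factor.
Qed.

(* Expand the product of the factors that [u] flips, one at a time: the term in
   which none of them is expanded is odd under [u], and adding factors back
   increases each of the others. *)
Lemma odd_step (a b : R) (chi : I -> V -> R) s w psi u :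
  0 < a -> 0 <= b ->
  (forall k, character (chi k)) -> positive_type w -> character psi ->
  u \in G -> psi u = -1 -> (forall c, w (c + u) = w c) ->
  a * gsum (fun c => psi c * (w c * \prod_(k <- s) (a + b * chi k c))) <=
  b * \sum_(k <- s)
     gsum (fun c => psi c * chi k c * (w c * \prod_(k <- s) (a + b * chi k c))).
Proof.
move=> a0 b0 hchi hw hpsi uG psiu wu.
(* [E d s'] is the weight in which [d] factors are already reduced to their constant [a] and those
   of [s'] are still to be expanded. *)
pose E d s' c : R := a ^+ d * w c * \prod_(k <- s') (a + b * chi k c).
suff main (s' : seq I) d : a * gsum (fun c => psi c * E d s' c) <=
    b * \sum_(k <- s') gsum (fun c => psi c * chi k c * E d s' c).
  have := main s 0%N; rewrite /E expr0.
  rewrite [X in _ * X](eq_gsum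
    (f' := fun c => psi c * (w c * \prod_(k <- s) (a + b * chi k c)))).
    move=> h; apply: le_trans h _; rewrite ler_wpM2l // le_eqVlt; apply/orP; left.
    by apply/eqP; apply: eq_bigr => k _; apply: eq_gsum => c _; rewrite mul1r.
  by move=> c _; rewrite mul1r.
have Epos d1 s1 : positive_type (E d1 s1).
  apply: positive_type_prod => //; first by move=> _; exact: ltW.
  move=> chi' hchi'; rewrite (eq_gsum (f' := fun c => a ^+ d1 * (w c * chi' c))).
    by rewrite gsumZ mulr_ge0 ?hw // exprn_ge0 // ltW.
  by move=> c _; rewrite mulrA.
elim: s' d => [|k s' IHs] d.
  rewrite big_nil mulr0 (@gsum_odd _ u) ?mulr0 // => c; rewrite /E !big_nil wu.
  by rewrite hpsi.2 psiu; ring.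
have Econs c : E d (k :: s') c = E d.+1 s' c + b * (chi k c * E d s' c).
  by rewrite /E big_cons exprS; ring.
have Ele chi' : character chi' -> gsum (fun c => chi' c * E d.+1 s' c) <=
    gsum (fun c => chi' c * E d (k :: s') c).
  move=> hchi'; rewrite [leRHS](eq_gsum (f' := fun c => chi' c * E d.+1 s' c +
     b * (E d s' c * (chi k c * chi' c)))); last by move=> c _; rewrite Econs; ring.
  rewrite gsumD gsumZ lerDl mulr_ge0 ?Epos //; exact: characterM.
rewrite big_cons mulrDr.
rewrite (eq_gsum (f' := fun c => psi c * E d.+1 s' c + b * (psi c * chi k c * E d s' c)));
  last by move=> c _; rewrite Econs; ring.
rewrite gsumD gsumZ mulrDr [leLHS]addrC lerD //.
  rewrite mulrCA ler_wpM2l //.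
  apply: le_trans (Ele _ (characterM hpsi (hchi k))).
  by rewrite -gsumZ le_eqVlt; apply/orP; left; apply/eqP; apply: eq_gsum => c _;
    rewrite /E exprS; ring.
apply: le_trans (IHs _) _; rewrite ler_wpM2l //.
by apply: ler_sum => k' _; apply: Ele; exact: characterM.
Qed.

End Products.
End CharTwo.

(** * Poincaré lemmas on the integer lattice *)

Section Cochains.
Variables (m : nat) (A : comNzRingType).
Implicit Types (f : vertex m -> A) (x y r : vertex m) (i j k : 'I_m).

Lemma shiftE x i k : (x + unit_vec i) 0 k = x 0 k + (k == i)%:Z.
Proof. by rewrite !mxE eqxx natz. Qed.

Lemma shift_otherE x i k : k != i -> (x + unit_vec i) 0 k = x 0 k.
Proof. by rewrite shiftE => /negPf ->; rewrite addr0. Qed.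

Lemma unshiftE x i k n : (x - unit_vec i *+ n) 0 k = x 0 k - (if k == i then n else 0%N)%:Z.
Proof. by rewrite !(mxE, mulmxnE) eqxx; case: eqP => _; rewrite ?mul0rn // pmulrn intz. Qed.

Lemma unshift_otherE x i k n : k != i -> (x - unit_vec i *+ n) 0 k = x 0 k.
Proof. by rewrite unshiftE => /negPf ->; rewrite subr0. Qed.

Definition pdiff i f x := f (x + unit_vec i) - f x.

Lemma pdiffC i j f x : pdiff i (pdiff j f) x = pdiff j (pdiff i f) x.
Proof. by rewrite /pdiff (addrAC x (unit_vec i)); ring. Qed.

Lemma eq_pdiff i f f' : f =1 f' -> pdiff i f =1 pdiff i f'.
Proof. by move=> h x; rewrite /pdiff !h. Qed.

Definition int_pos (z : int) : nat := if z is Posz n then n else 0%N.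

Lemma int_posE z : 0 <= z -> (int_pos z)%:Z = z.
Proof. by case: z. Qed.

Lemma int_pos_le0 z : z <= 0 -> int_pos z = 0%N.
Proof. by case: z => // -[]. Qed.

Lemma int_pos_lt z z' : z < z' -> 0 < z' -> (int_pos z < int_pos z')%N.
Proof. by case: z z' => [n|n] [n'|n'] //=; lia. Qed.

(* The discrete antiderivative in direction [i] that vanishes on [x_i <= lo]. *)
Definition psum i (lo : int) f x : A :=
  \sum_(l < int_pos (x 0 i - lo)) f (x - unit_vec i *+ l.+1).

Lemma psum_low i lo f x : x 0 i <= lo -> psum i lo f x = 0.
Proof. by move=> h; rewrite /psum int_pos_le0 ?big_ord0 // subr_le0. Qed.

Lemma psum_eq0 i lo f x :
  (forall n, (n < int_pos (x 0 i - lo)%R)%N -> f (x - unit_vec i *+ n.+1) = 0) ->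
  psum i lo f x = 0.
Proof. by move=> h; apply: big1 => l _; rewrite h. Qed.

Lemma pdiff_psum i lo f x : (x 0 i < lo -> f x = 0) -> pdiff i (psum i lo f) x = f x.
Proof.
move=> fx; rewrite /pdiff; have [xlo|xlo] := ltP (x 0 i) lo.
  rewrite !psum_low ?subr0 ?fx //; first exact: ltW.
  by rewrite shiftE eqxx; lia.
rewrite /psum shiftE eqxx -[Posz true]/(1 : int).
have -> : int_pos (x 0 i + 1 - lo) = (int_pos (x 0 i - lo)).+1.
  have := @int_posE (x 0 i + 1 - lo).
  by have := @int_posE (x 0 i - lo); lia.
rewrite big_ord_recl /= mulr1n addrK; under eq_bigr => l _.
  rewrite /bump add1n mulrS opprD addrA addrK; over.
by rewrite addrK.
Qed.

Lemma pdiff_psum_other i j lo f x : j != i ->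
  pdiff j (psum i lo f) x = psum i lo (pdiff j f) x.
Proof.
move=> ji; rewrite /pdiff /psum shift_otherE 1?eq_sym // -sumrB.
by apply: eq_bigr => l _; rewrite addrAC.
Qed.

(** Walk backwards along direction [i], where [f] does not change, down to the region on which it
    vanishes; [P] is a region that such a walk does not leave. *)
Lemma pdiff_eq0 (P : vertex m -> Prop) i lo f :
  (forall x, P x -> P (x - unit_vec i)) ->
  (forall x, P x -> x 0 i <= lo -> f x = 0) ->
  (forall x, P x -> pdiff i f x = 0) -> forall x, P x -> f x = 0.
Proof.
move=> hP hlow hdiff x Px; have [n] := ubnP (int_pos (x 0 i - lo)).
elim: n => // n IHn in x Px *; have [xlo _|xlo hn] := leP (x 0 i) lo; first exact: hlow.
have := hdiff _ (hP _ Px); rewrite /pdiff subrK => /eqP.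
rewrite subr_eq0 => /eqP ->; apply: IHn; first exact: hP.
have := unshiftE x i i 1; rewrite [unit_vec _ *+ _]mulr1n eqxx -[Posz _]/(1 : int) => ->.
by apply: leq_trans (int_pos_lt _ _) hn; lia.
Qed.

Definition cube r (D : nat) x := [forall k, `|x 0 k - r 0 k| <= D%:Z].

Lemma cubePn r D x : reflect (exists k, x 0 k <= r 0 k - D%:Z - 1 \/ r 0 k + D%:Z + 1 <= x 0 k)
  (~~ cube r D x).
Proof.
apply: (iffP forallPn) => -[k hk]; exists k; move: hk; rewrite ler_norml; lia.
Qed.

(** Integrating [K] along the first axis gives a primitive [t] that vanishes away from the cube
    except above it. There [K = 0], so [t] is the gradient of a function [th], which vanishes
    outside the shadow of the cube. Subtracting the gradient of [th], cut off to the region above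
    the cube, leaves compact support. *)
Lemma compact_poincare (K : vertex m -> 'I_m -> 'I_m -> A) r D :
  (3 <= m)%N ->
  (forall x i, K x i i = 0) -> (forall x i j, K x i j = - K x j i) ->
  (forall x i j k, pdiff i (fun y => K y j k) x + pdiff j (fun y => K y k i) x
     + pdiff k (fun y => K y i j) x = 0) ->
  (forall x i j, ~~ cube r D x -> K x i j = 0) ->
  exists tau : vertex m -> 'I_m -> A,
    (forall x i j, pdiff i (tau^~ j) x - pdiff j (tau^~ i) x = K x i j) /\
    (forall x i, ~~ cube r D.+1 x -> tau x i = 0).
Proof.
move=> hm K0 KN Kclosed Ksupp.
have h0 : (0 < m)%N by lia. have h1 : (1 < m)%N by lia. have h2 : (2 < m)%N by lia.
(* The numbers [lo] and [hi] are the coordinates just outside the cube on its two sides, where [K]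
   already vanishes. *)
pose i1 := Ordinal h0; pose i2 := Ordinal h1; pose i3 := Ordinal h2.
pose lo k := r 0 k - D%:Z - 1; pose hi k := r 0 k + D%:Z + 1.
have Kout x i j k : x 0 k <= lo k \/ hi k <= x 0 k -> K x i j = 0.
  by move=> h; apply: Ksupp; apply/cubePn; exists k.
pose t j := psum i1 (lo i1) (fun y => K y i1 j).
have dt j x : pdiff i1 (t j) x = K x i1 j.
  by rewrite pdiff_psum // => /ltW h; apply: (Kout _ _ _ i1); left.
have t_low j x : x 0 i1 <= lo i1 -> t j x = 0 by apply: psum_low.
have t_out j x k : k != i1 -> x 0 k <= lo k \/ hi k <= x 0 k -> t j x = 0.
  move=> ki1 h; apply: psum_eq0 => n _; apply: (Kout _ _ _ k).
  by rewrite unshift_otherE.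
have t_i1 x : t i1 x = 0 by apply: psum_eq0.
have hK i j x : pdiff i (t j) x - pdiff j (t i) x = K x i j.
  have [->|ii1] := eqVneq i i1; first by rewrite dt /pdiff !t_i1 !subr0.
  have [->|ji1] := eqVneq j i1.
    by rewrite dt /pdiff !t_i1 subrr sub0r -KN.
  apply/eqP; rewrite -subr_eq0; apply/eqP.
  (* Both sides vanish below the cube, and closedness of [K] makes their differences along [i1]
     agree. *)
  pose f y := pdiff i (t j) y - pdiff j (t i) y - K y i j; rewrite -/(f x).
  apply: (@pdiff_eq0 (fun=> True) i1 (lo i1)) => // {}x _.
    move=> hx; rewrite /f /pdiff (Kout _ _ _ i1); last by left.
    by rewrite !t_low ?shift_otherE 1?eq_sym // !subr0.
  have -> : pdiff i1 f x = pdiff i (pdiff i1 (t j)) x - pdiff j (pdiff i1 (t i)) x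
      - pdiff i1 (fun y => K y i j) x.
    by rewrite -!(pdiffC i1) /pdiff /f /pdiff; ring.
  rewrite (eq_pdiff _ (dt j)) (eq_pdiff _ (dt i)).
  have := Kclosed x i1 i j; rewrite /pdiff.
  rewrite (KN x j i1) (KN (x + unit_vec i) j i1) => /eqP.
  rewrite addr_eq0 => /eqP h.
  by apply: (@addIr _ (- (K (x + unit_vec j) i1 i - K x i1 i))); rewrite -h; ring.
have i21 : i2 != i1 by []. have i31 : i3 != i1 by []. have i32 : i3 != i2 by [].
pose th := psum i2 (lo i2) (t i2).
have dth x : pdiff i2 th x = t i2 x.
  by rewrite pdiff_psum // => /ltW h; apply: (t_out _ _ i2) => //; left.
(* The half-space above the cube, in which [t] is closed. *)
pose P x := hi i1 <= x 0 i1.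
have PB x k : k != i1 -> P x -> P (x - unit_vec k).
  by move=> ki1; rewrite /P -[unit_vec k]mulr1n unshift_otherE // eq_sym.
have dthP j x : P x -> pdiff j th x = t j x.
  move=> Px; have [->|ji2] := eqVneq j i2; first exact: dth.
  apply/eqP; rewrite -subr_eq0; apply/eqP.
  pose f y := pdiff j th y - t j y; rewrite -/(f x).
  apply: (@pdiff_eq0 P i2 (lo i2)) => // {Px}x; first exact: PB.
    move=> _ hx; rewrite /f /pdiff /th !psum_low ?shift_otherE 1?eq_sym //.
    by rewrite (t_out _ _ i2) // ?subrr //; left.
  move=> Px.
  have -> : pdiff i2 f x = pdiff j (pdiff i2 th) x - pdiff i2 (t j) x.
    by rewrite -(pdiffC i2) /pdiff /f /pdiff; ring.
  rewrite (eq_pdiff _ dth) -opprB hK (Kout _ _ _ i1) ?oppr0 //; by right.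
have th_out x k : P x -> k != i1 -> x 0 k <= lo k \/ hi k <= x 0 k -> th x = 0.
  have th_out' y l : l != i1 -> l != i2 -> y 0 l <= lo l \/ hi l <= y 0 l -> th y = 0.
    move=> li1 li2 h; apply: psum_eq0 => n _; apply: (t_out _ _ l) => //.
    by rewrite unshift_otherE.
  move=> Px ki1; have [->|ki2] := eqVneq k i2; last exact: th_out'.
  case=> [|h]; first exact: psum_low.
  (* Beyond [hi i2] the function [th] is constant along [i3] and vanishes for small third
     coordinate. This third axis is where [m >= 3] enters. *)
  apply: (@pdiff_eq0 (fun y => P y /\ hi i2 <= y 0 i2) i3 (lo i3)) => // {}y [Py hy].
  - by split; [exact: PB|rewrite -[unit_vec _]mulr1n unshift_otherE].
  - by move=> hy3; apply: (th_out' _ i3) => //; left.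
  by rewrite dthP // (t_out _ _ i2) //; right.
pose th1 x := if hi i1 <= x 0 i1 then th x else 0.
exists (fun x j => t j x - pdiff j th1 x); split=> [x i j|x j].
  rewrite -hK; have := pdiffC i j th1 x; rewrite /pdiff => /eqP.
  by rewrite -subr_eq0 => /eqP h; rewrite -[RHS]subr0 -h; ring.
move=> /cubePn[k hk]; rewrite /pdiff /th1.
have [hx|hx] := boolP (hi i1 <= x 0 i1).
  have -> : hi i1 <= (x + unit_vec j) 0 i1.
    by rewrite shiftE; case: (_ == _); rewrite ?addr0 //; lia.
  by rewrite -/(pdiff j th x) dthP ?subrr.
have -> : t j x = 0.
  have [ki1|ki1] := eqVneq k i1; last by apply: (t_out _ _ k) => //; move: hk; rewrite /lo /hi; lia.
  by move: hk hx; rewrite ki1 => hk hx; apply: t_low; move: hk hx; rewrite /lo /hi -ltNge; lia.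
case: ifP => hx'; last by rewrite !subr0.
(* Only an edge in direction [i1] enters the half-space from outside. *)
have j1 : j = i1.
  by apply/eqP; apply: contraNT hx => ji1; move: hx'; rewrite shift_otherE // eq_sym.
rewrite (th_out _ k) ?subrr //.
  by apply/eqP => ki1; move: hk hx; rewrite ki1 /hi -ltNge; move: hx'; rewrite shiftE j1 eqxx /hi; lia.
rewrite shiftE; move: hk; rewrite /lo /hi; case: (_ == _) => /=; lia.
Qed.

(** Gauge fixing one direction at a time: once a gradient has been subtracted the components below
    [n] vanish, and integrating component [n] from the face at [- M] keeps them zero by flatness. *)
Lemma cube_poincare (s : vertex m -> 'I_m -> A) M :
  (forall x i j, cube 0 M x -> pdiff i (s^~ j) x = pdiff j (s^~ i) x) ->
  exists th : vertex m -> A, forall x i, cube 0 M x -> s x i = pdiff i th x.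
Proof.
move=> flat.
suff main n : exists th : vertex m -> A,
    forall x i, (i < n)%N -> cube 0 M x -> s x i = pdiff i th x.
  by have [th hth] := main m; exists th => x i; apply: hth.
elim: n => [|n [th hth]]; first by exists (fun=> 0).
have [nm|nm] := ltnP n m; last first.
  exists th => x i _; apply: hth; exact: leq_trans (ltn_ord i) nm.
pose k := Ordinal nm; pose s' x i := s x i - pdiff i th x.
have flat' x i j : cube 0 M x -> pdiff i (s'^~ j) x = pdiff j (s'^~ i) x.
  move=> hx; have := flat x i j hx; have := pdiffC i j th x.
  rewrite /s' /pdiff => /eqP; rewrite -subr_eq0 => /eqP h1 /eqP; rewrite -subr_eq0 => /eqP h2.
  apply/eqP; rewrite -subr_eq0; apply/eqP.
  transitivity (0 - 0 : A); last by rewrite subr0.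
  by rewrite -{1}h2 -h1; ring.
exists (fun x => th x + psum k (- M%:Z) (s'^~ k) x) => x i iSn hx.
have -> : pdiff i (fun x => th x + psum k (- M%:Z) (s'^~ k) x) x =
  pdiff i th x + pdiff i (psum k (- M%:Z) (s'^~ k)) x by rewrite /pdiff; ring.
have hxk : (- M%:Z <= x 0 k).
  by have /forallP/(_ k) := hx; rewrite mxE ler_norml; lia.
have [->|ik] := eqVneq i k.
  by rewrite pdiff_psum ?/s' 1?addrC ?subrK // ltNge hxk.
have ltin : (i < n)%N by move: ik; rewrite -val_eqE /=; lia.
rewrite pdiff_psum_other // psum_eq0 ?addr0 ?hth // => l hl.
(* The sum starts at a face, so it only visits points of the cube, where flatness is available. *)
have hy (l' : nat) : (l' <= l.+1)%N -> cube 0 M (x - unit_vec k *+ l').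
  move=> hl'; apply/forallP => a; have /forallP/(_ a) := hx; rewrite unshiftE !mxE.
  case: eqP => [->|_]; last by rewrite !subr0.
  move: hl hxk; have := @int_posE (x 0 k + M%:Z); rewrite opprK => h1 h2 h3.
  by have := h1 _; rewrite !ler_norml; lia.
rewrite flat'; last exact: hy.
have e : x - unit_vec k *+ l.+1 + unit_vec k = x - unit_vec k *+ l.
  by rewrite mulrSr opprD addrA subrK.
by rewrite /pdiff e /s' !hth ?subrr //; exact: hy.
Qed.

End Cochains.

(** * Clusters of bad sites *)

Section Clusters.
Variables (m : nat).
Implicit Types (x y r : vertex m) (i j k : 'I_m).

Lemma cubeC r D x : cube r D x = cube x D r.
Proof. by apply: eq_forallb => k; rewrite distrC. Qed.

Lemma cubexx r D : cube r D r.
Proof. by apply/forallP => k; rewrite subrr normr0. Qed.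

Lemma cubeS r D D' x : (D <= D')%N -> cube r D x -> cube r D' x.
Proof.
move=> DD' /forallP h; apply/forallP => k; apply: le_trans (h k) _.
by rewrite lez_nat.
Qed.

Lemma cube_trans y r D D' x : cube r D y -> cube y D' x -> cube r (D + D') x.
Proof.
move=> /forallP h /forallP h'; apply/forallP => k; have := h k; have := h' k.
rewrite !ler_norml; lia.
Qed.

Lemma cube0 N x : cube 0 N x = (x \in box m N).
Proof. by rewrite mem_box; apply: eq_forallb => k; rewrite mxE subr0. Qed.

Lemma cube_shift x i : cube x 1 (x + unit_vec i).
Proof. by apply/forallP => k; rewrite shiftE; case: (_ == _); lia. Qed.

Lemma cube_shift2 x i j : cube (x + unit_vec i) 1 (x + unit_vec j).
Proof. by apply/forallP => k; rewrite !shiftE; case: (_ == _); case: (_ == _); lia. Qed.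

(** Diagonal neighbours count as adjacent, so that the four sites entering the closedness relation
    of a 2-cochain at a point are pairwise adjacent. *)
Definition star x y := cube x 1 y.

Lemma path_cube x p : path star x p -> cube x (size p) (last x p).
Proof.
elim: p x => [|y p IHp] x /=; first by rewrite cubexx.
by move=> /andP[xy /IHp]; rewrite -add1n; exact: cube_trans.
Qed.

Section Bad.
Variables (n : nat) (g : {pred vertex m}).
Local Notation B := (box m n.+1).
Local Notation T := (fset_sub_type B).

(* A self-avoiding path of bad sites that starts at distance at most its
   length from [v]. *)
Definition bad_path v (y : vertex m) (p : seq (vertex m)) :=
  [&& uniq (y :: p), path star y p,
      all (fun z => (z \in B) && (z \notin g)) (y :: p) & cube y (size p).+1 v].

Definition bad (x : T) := val x \notin g.
Definition bad_rel (x y : T) := [&& bad x, bad y & star (val x) (val y)].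

Lemma bad_rel_sym : connect_sym bad_rel.
Proof.
apply: sym_connect_sym => x y; rewrite /bad_rel /star cubeC.
by rewrite andbCA.
Qed.

Implicit Types (c : T).

(** Clusters are indexed by all sites of the box; the one of [c] is empty unless [c] is bad and is
    the canonical root of its component. *)
Definition cluster c x : bool :=
  if insub x is Some x' then bad x' && (fingraph.root bad_rel x' == c) else false.

Lemma clusterP c x :
  reflect (exists x' : T, [/\ val x' = x, bad x' & fingraph.root bad_rel x' = c]) (cluster c x).
Proof.
rewrite /cluster; case: insubP => [x' _ <-|hx].
  apply: (iffP andP) => [[bx /eqP rx]|[y [/val_inj -> -> ->]]] //; by exists x'.
by constructor => -[x' [e _ _]]; rewrite -e (valP x') in hx.
Qed.

(** A cluster that reaches distance [l] from [x] contains a self-avoiding path from [x] with at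
    least [l] steps, of which the first [l] are kept. *)
Lemma cluster_bad_path (x y : T) v l : bad x -> connect bad_rel x y ->
  (forall l', (l' < l)%N -> ~~ cube (val x) l' (val y)) -> cube (val x) l.+1 v ->
  exists p, bad_path v (val x) p.
Proof.
move=> bx /connectP[p0 hp0 ->] {y}; case/shortenP: hp0 => p hp up _ hl hv.
have valpath (z : T) q : path bad_rel z q -> path star (val z) (map val q).
  by elim: q z => //= a q IHq z /andP[/and3P[_ _ ->] /IHq].
have hsz : (l <= size p)%N.
  rewrite leqNgt; apply/negP => /hl /negP; apply.
  by rewrite -(last_map val) -(size_map val); apply/path_cube/valpath.
exists (map val (take l p)); rewrite /bad_path size_map size_takel // hv andbT.
rewrite valpath ?take_path // -map_cons (map_inj_uniq val_inj).
rewrite (subseq_uniq _ up) ?andTb; last first.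
  by rewrite -[X in subseq _ X]/(x :: p) /= eqxx take_subseq.
have /allP hall : all bad (x :: p).
  rewrite /= bx /=; elim: p x {hl hv up hsz bx} hp => //= a q IHq z.
  by move=> /andP[/and3P[_ -> _] /IHq].
apply/allP => _ /mapP[z hz ->]; rewrite (valP z) /=; apply: hall.
by move: hz; rewrite !inE => /orP[->//|/mem_take ->]; rewrite orbT.
Qed.

End Bad.
End Clusters.

(** * Removing the curvature cluster by cluster *)

Section FlatPotential.
Variables (m n : nat) (A : comNzRingType) (g : {pred vertex m}).
Variable (s : vertex m -> 'I_m -> A).
Hypothesis hm : (3 <= m)%N.
Local Notation B := (box m n.+1).
Local Notation T := (fset_sub_type B).
Local Notation cl := (@cluster m n g).
Let K x i j := pdiff i (s^~ j) x - pdiff j (s^~ i) x.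
Hypothesis flat : forall x i j, x \in B -> x \in g -> K x i j = 0.

Let Kc (c : T) x i j := if cl c x then K x i j else 0.

(** A neighbour with nonzero curvature is bad, hence in the same cluster, so restricting [K] to the
    cluster changes nothing next to it. As [x] is in [box m n], the neighbour is still in [B]. *)
Lemma cluster_neighbor (c : T) x y i j :
  cl c x -> x \in box m n -> cube x 1 y -> Kc c y i j = K y i j.
Proof.
move=> /clusterP[x' [<- bx rx]] hx xy; rewrite /Kc; case: ifP => // /negbT hy.
apply/esym/eqP; apply: contraNT hy => Ky.
have yB : y \in B.
  rewrite -cube0 -[n.+1]addn1; apply: cube_trans xy; by rewrite cube0.
have by' : y \notin g by apply: contra Ky => yg; rewrite flat.
pose y' : T := [` yB]%fset; apply/clusterP; exists y'; split=> //.
rewrite -rx; apply/esym/eqP; rewrite (root_connect (bad_rel_sym _)).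
by apply: connect1; apply/and3P.
Qed.

(** A curvature is closed. Either one of the four sites involved is in the cluster, and then [Kc]
    agrees with [K] at all of them, or [Kc] vanishes at all four. *)
Lemma cluster_closed (c : T) : (forall x, cl c x -> x \in box m n) ->
  forall x i j k, pdiff i (fun y => Kc c y j k) x + pdiff j (fun y => Kc c y k i) x
     + pdiff k (fun y => Kc c y i j) x = 0.
Proof.
move=> hint x i j k.
have Kclosed : pdiff i (fun y => K y j k) x + pdiff j (fun y => K y k i) x
     + pdiff k (fun y => K y i j) x = 0.
  rewrite /K /pdiff !(addrAC x (unit_vec k)) !(addrAC x (unit_vec j) (unit_vec i)); ring.
have all_eq y : cl c y -> cube y 1 x -> cube y 1 (x + unit_vec i) ->
   cube y 1 (x + unit_vec j) -> cube y 1 (x + unit_vec k) ->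
   pdiff i (fun y => Kc c y j k) x + pdiff j (fun y => Kc c y k i) x
     + pdiff k (fun y => Kc c y i j) x = 0.
  move=> cy h0 hi hj hk; rewrite -[RHS]Kclosed /pdiff.
  by rewrite !(cluster_neighbor _ _ cy (hint _ cy)).
have [h0|h0] := boolP (cl c x).
  by apply: (all_eq x) => //; rewrite ?cubexx ?cube_shift.
have [hi|hi] := boolP (cl c (x + unit_vec i)).
  by apply: (all_eq _ hi); rewrite ?cube_shift2 // cubeC cube_shift.
have [hj|hj] := boolP (cl c (x + unit_vec j)).
  by apply: (all_eq _ hj); rewrite ?cube_shift2 // cubeC cube_shift.
have [hk|hk] := boolP (cl c (x + unit_vec k)).
  by apply: (all_eq _ hk); rewrite ?cube_shift2 // cubeC cube_shift.
rewrite /Kc /pdiff (negPf h0) (negPf hi) (negPf hj) (negPf hk); ring.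
Qed.

(** Take the least [D] such that the cluster stays within distance [D] of its root. The potential
    lives within [D.+1], and by minimality the root starts a bad path of [D] steps; so each site
    where [t] is nonzero is reached by a bad path. Empty clusters and those leaving [box m n] get
    [t = 0]. *)
Lemma cluster_potential (c : T) :
  exists t : vertex m -> 'I_m -> A,
    ((forall x, cl c x -> x \in box m n) ->
       forall x i j, pdiff i (t^~ j) x - pdiff j (t^~ i) x = Kc c x i j) /\
    forall v, (forall y p, ~~ bad_path n g v y p) -> forall i, t v i = 0.
Proof.
have [/forallP hint|hint] := boolP [forall x : T, cl c (val x) ==> (val x \in box m n)]; last first.
  exists (fun _ _ => 0); split=> // h; case/negP: hint; apply/forallP => x.
  by apply/implyP; apply: h.
have {}hint x : cl c x -> x \in box m n.
  move=> hx; case/clusterP: (hx) => x' [e _ _]; have := hint x'.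
  by rewrite e => /implyP; apply.
have [/existsP[x0 hx0]|/existsPn hN] := boolP [exists x : T, cl c (val x)]; last first.
  exists (fun _ _ => 0); split=> // _ x i j; rewrite /Kc /pdiff.
  have clN y : cl c y = false.
    by apply/negP => hy; case/clusterP: (hy) => y' [e _ _]; have := hN y'; rewrite e hy.
  by rewrite !clN !subr0.
have [bc rc] : bad g c /\ fingraph.root (bad_rel g) c = c.
  case/clusterP: hx0 => x' [_ bx rx].
  rewrite -rx; split; last exact: root_root (bad_rel_sym _) _.
  have blast p : forall a, bad g a -> path (bad_rel g) a p -> bad g (last a p).
    by elim: p => //= b p IHp a _ /andP[/and3P[_ bb _]]; exact: IHp.
  by case/connectP: (connect_root (bad_rel g) x') => p hp ->; exact: blast.
pose inD D := [forall x : T, cl c (val x) ==> cube (val c) D (val x)].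
have exD : exists D, inD D.
  exists (n.+1 + n.+1)%N; apply/forallP => x; apply/implyP => _.
  by apply: (@cube_trans _ 0); rewrite ?[cube _ _ 0]cubeC cube0; exact: fsvalP.
case: (ex_minnP exD) => D /forallP hD minD.
have Dsupp x : cl c x -> cube (val c) D x.
  move=> hx; case/clusterP: (hx) => x' [e _ _]; have := hD x'.
  by rewrite e => /implyP; apply.
have Dpath v : cube (val c) D.+1 v -> exists p, bad_path n g v (val c) p.
  have [x [hx hl]] : exists x : T, cl c (val x) /\ forall l, (l < D)%N -> ~~ cube (val c) l (val x).
    case: (posnP D) => [->|D0]; first by exists x0; split=> // l; rewrite ltn0.
    have : ~~ inD D.-1 by apply/negP => /minD; lia.
    move=> /forallPn[x]; rewrite negb_imply => /andP[hx hxD]; exists x; split=> // l lD.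
    by apply: contra hxD; apply: cubeS; lia.
  apply: (@cluster_bad_path _ _ _ c x) => //.
  rewrite -(root_connect (bad_rel_sym _)) rc; apply/eqP.
  by case/clusterP: hx => x' [/val_inj -> _ ->].
case: (@compact_poincare _ A (Kc c) (val c) D hm).
- by move=> x i; rewrite /Kc /K; case: ifP => //; rewrite subrr.
- by move=> x i j; rewrite /Kc /K; case: ifP => _; rewrite ?oppr0 ?opprB.
- exact: cluster_closed.
- by move=> x i j hx; rewrite /Kc; case: ifP => // /Dsupp hx'; rewrite hx' in hx.
move=> t [dt t0]; exists t; split=> // v hv i; apply: t0; apply/negP => /Dpath[p].
by apply/negP.
Qed.

(** Subtracting the potentials of the interior clusters leaves a field that is flat on the small
    box, hence a gradient there. These potentials vanish at the base points of [F]. *)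
Lemma flat_potential M (F : seq (edge m)) : (3 * M <= n)%N ->
  (forall e, e \in F -> e.1 \in box m M) ->
  (forall e, e \in F -> forall y p, ~~ bad_path n g e.1 y p) ->
  exists th, forall e, e \in F -> s e.1 e.2 = pdiff e.2 th e.1.
Proof.
move=> Mn FM Fgood; case: F => [|e0 F] in FM Fgood *; first by exists (fun=> 0).
have e0F : e0 \in e0 :: F by rewrite mem_head.
have /(@choice _ _ _)[t ht] := cluster_potential.
pose I := [pred c : T | [forall x : T, cl c (val x) ==> (val x \in box m n)]].
have dt c : I c -> forall x i j, pdiff i ((t c)^~ j) x - pdiff j ((t c)^~ i) x = Kc c x i j.
  move=> /forallP hc; apply: (ht c).1 => x hx; case/clusterP: (hx) => x' [e _ _].
  by have := hc x'; rewrite e => /implyP; apply.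
pose s' x i := s x i - \sum_(c | I c) t c x i.
have ds' x i j : pdiff i (s'^~ j) x - pdiff j (s'^~ i) x = K x i j - \sum_(c | I c) Kc c x i j.
  rewrite -(eq_bigr _ (fun c hc => dt c hc x i j)) /s' /K /pdiff !sumrB; ring.
have [|th hth] := @cube_poincare _ A s' M.
  move=> x i j; rewrite cube0 => xM; apply/eqP; rewrite -subr_eq0 ds' subr_eq0.
  have xB : x \in B by rewrite -cube0; apply: cubeS (_ : M <= _)%N _; rewrite ?cube0 //; lia.
  have [xg|xg] := boolP (x \in g).
    by rewrite flat // big1 // => c _; rewrite /Kc; case: ifP => // _; rewrite flat.
  pose x' : T := [` xB]%fset; pose c := fingraph.root (bad_rel g) x'.
  have bx : bad g x' by [].
  have cx : cl c x by apply/clusterP; exists x'.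
  rewrite (bigD1 c) /=; last first.
    apply/forallP => y; apply/implyP => /clusterP[y' [/val_inj -> by' ry]].
    (* A cluster that meets the small box and leaves [box m n] is so long that, since [3 * M <= n],
       it yields a bad path around [e0.1]. *)
    apply: contraT => yn; have xe : cube x (M + M) e0.1.
      by apply: (@cube_trans _ 0); rewrite ?[cube _ _ 0]cubeC cube0 // FM.
    have [] := @cluster_bad_path _ _ g x' y e0.1 (n.+1 - M)%N bx.
    - by rewrite -(root_connect (bad_rel_sym _)) ry.
    - move=> l hl; apply: contra yn => /(cube_trans (_ : cube 0 M x)).
      rewrite cube0 => /(_ xM) h; rewrite -cube0; apply: cubeS h; lia.
    - by apply: cubeS xe; lia.
    by move=> p hp; have := Fgood _ e0F (val x') p; rewrite hp.
  rewrite {1}/Kc cx big1 ?addr0 // => c' /andP[_ c'c]; rewrite /Kc; case: ifP => //.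
  move=> /clusterP[x2 [e2 _ r2]]; case/eqP: c'c; rewrite -r2 /c; congr (fingraph.root _ _).
  by apply: val_inj.
exists th => e eF; rewrite -hth ?cube0 ?FM // /s' big1 ?subr0 // => c _.
by apply: (ht c).2; apply: Fgood.
Qed.

End FlatPotential.

(** * Bernoulli percolation *)

Section Percolation.
Variables (R : realFieldType) (V : eqType) (eps : R).
Hypothesis eps01 : 0 <= eps <= 1.
Implicit Types (l g s : seq V) (f : seq V -> R).

(* The expectation of [f] at [g] to which every site of [l] is added,
   independently, with probability [1 - eps]. *)
Fixpoint perc l f g : R :=
  if l is v :: l' then eps * perc l' f g + (1 - eps) * perc l' f (v :: g) else f g.

Definition increasing_obs f := forall g g', {subset g <= g'} -> f g <= f g'.

Lemma perc_le l f f' g : (forall g, f g <= f' g) -> perc l f g <= perc l f' g.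
Proof.
move=> h; elim: l g => //= v l IHl g; case/andP: eps01 => e0 e1.
by rewrite lerD // ler_wpM2l ?subr_ge0.
Qed.

Lemma perc_increasing l f : increasing_obs f -> increasing_obs (perc l f).
Proof.
move=> hf; elim: l => //= v l IHl g g' gg'; case/andP: eps01 => e0 e1.
rewrite lerD // ler_wpM2l ?subr_ge0 //; apply: IHl => // z; rewrite !inE.
by case/orP => [->//|/gg' ->]; rewrite orbT.
Qed.

Lemma perc_cst l c g : perc l (fun=> c) g = c.
Proof. by elim: l g => //= v l IHl g; rewrite !IHl; ring. Qed.

Lemma percD l f f' g : perc l (fun g => f g + f' g) g = perc l f g + perc l f' g.
Proof. by elim: l g => //= v l IHl g; rewrite !IHl; ring. Qed.

Lemma perc_sum (I : Type) l (r : seq I) (f : I -> seq V -> R) g :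
  perc l (fun g => \sum_(k <- r) f k g) g = \sum_(k <- r) perc l (f k) g.
Proof.
elim: r => [|k r IHr].
  by rewrite big_nil -[RHS](perc_cst l 0 g); congr perc; apply/funext => ?; rewrite big_nil.
rewrite big_cons -IHr -percD.
by congr perc; apply/funext => ?; rewrite big_cons.
Qed.

(** Conditioning on one site at a time: its state adds the covariance eps (1 - eps) (c - a) (d - b),
    which is nonnegative for increasing functions. *)
Lemma perc_harris l f f' g : increasing_obs f -> increasing_obs f' ->
  perc l f g * perc l f' g <= perc l (fun g => f g * f' g) g.
Proof.
move=> hf hf'; elim: l g => //= v l IHl g; case/andP: eps01 => e0 e1.
have sub : {subset g <= v :: g} by move=> z zg; rewrite inE zg orbT.
have h := perc_increasing l hf sub; have h' := perc_increasing l hf' sub.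
have h1 := IHl g; have h2 := IHl (v :: g).
have h3 : eps * perc l (fun g => f g * f' g) g + (1 - eps) * perc l (fun g => f g * f' g) (v :: g)
  >= eps * (perc l f g * perc l f' g) + (1 - eps) * (perc l f (v :: g) * perc l f' (v :: g)).
  by rewrite lerD // ler_wpM2l ?subr_ge0.
apply: le_trans h3; rewrite -subr_ge0.
move: h h'; move: (perc l f g) (perc l f' g) (perc l f (v :: g)) (perc l f' (v :: g)).
move=> a b c d ac bd.
have -> : eps * (a * b) + (1 - eps) * (c * d) - (eps * a + (1 - eps) * c) * (eps * b + (1 - eps) * d)
  = eps * (1 - eps) * ((c - a) * (d - b)) by ring.
by rewrite !mulr_ge0 ?subr_ge0.
Qed.

Lemma perc_harris_all (I : Type) l (r : seq I) (P : I -> seq V -> bool) g c :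
  0 <= c -> (forall k, increasing_obs (fun g => (P k g)%:R)) ->
  (forall k, c <= perc l (fun g => (P k g)%:R) g) ->
  c ^+ size r <= perc l (fun g => (all (P^~ g) r)%:R) g.
Proof.
move=> c0 hP hc; elim: r => [|k r IHr] /=; first by rewrite expr0 perc_cst.
rewrite exprS; apply: le_trans (ler_pM _ _ (hc k) IHr) _ => //; first exact: exprn_ge0.
apply: le_trans (perc_harris _ _ (hP k) _) _.
  move=> g1 g2 hg; elim: (r) => //= k' r' IHr'.
  by have := hP k' _ _ hg; case: (P k' g1); case: (P k' g2) => //=; rewrite ?ler10 // ler0n.
by apply: perc_le => g'; case: (P k g'); rewrite ?mul1r ?mul0r.
Qed.

(** An inequality rather than an equality because [g] may already meet [s]. *)
Lemma perc_closed l s g : uniq l -> uniq s ->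
  perc l (fun g => (all (fun z => z \notin g) s)%:R) g <= eps ^+ count (mem l) s.
Proof.
case/andP: eps01 => e0 e1; elim: l g => [g _ _|v l IHl g] /=.
  by rewrite (eq_count (a2 := pred0)) // count_pred0 expr0; case: all.
case/andP=> vl ul us; have h1 := IHl g ul us; have h2 := IHl (v :: g) ul us.
have [vs|vs] := boolP (v \in s).
  have -> : count (mem (v :: l)) s = (count (mem l) s).+1.
    have := count_predUI (pred1 v) (mem l) s; rewrite (count_uniq_mem _ us) vs.
    rewrite (eq_count (a1 := predI _ _) (a2 := pred0)) => [|z /=].
      by rewrite count_pred0 addn0 add1n => <-; apply: eq_count => z; rewrite /= inE.
    by case: eqP => // ->; exact: negbTE.
  have -> : perc l (fun g => (all (fun z => z \notin g) s)%:R) (v :: g) = 0.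
    have : v \in v :: g by rewrite mem_head.
    elim: (l) (v :: g) {h2} => /= [g'|a l' IHl' g'] hv.
      case: allP => // /(_ _ vs); by rewrite hv.
    by rewrite !IHl' ?inE ?hv ?orbT // !mulr0 addr0.
  by rewrite mulr0 addr0 exprS ler_wpM2l.
have -> : count (mem (v :: l)) s = count (mem l) s.
  apply: eq_in_count => z zs /=; rewrite inE; case: eqP => // zv.
  by move: zs; rewrite zv (negPf vs).
apply: le_trans (_ : eps * eps ^+ count (mem l) s + (1 - eps) * eps ^+ count (mem l) s <= _).
  by rewrite lerD // ler_wpM2l ?subr_ge0.
by rewrite -mulrDl addrC subrK mul1r.
Qed.

End Percolation.

(** * Peierls estimate for good sites *)

Section GoodSites.
Variables (R : realFieldType) (m n : nat).
Local Notation B := (box m n.+1).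
Implicit Types (x y v : vertex m).

Lemma card_box N : (#|` box m N| <= N.*2.+1 ^ m)%N.
Proof.
by apply: leq_trans (leq_imfset_card _ _ _) _; rewrite -cardE card_ffun !card_ord.
Qed.

Definition around N x : seq (vertex m) := [seq x + d | d <- enum_fset (box m N)].

Lemma mem_around N x y : cube x N y -> y \in around N x.
Proof.
move=> h; apply/mapP; exists (y - x); last by rewrite addrC subrK.
have : y - x \in box m N by rewrite -cube0; apply/forallP => k; have /forallP/(_ k) := h; rewrite !mxE subr0.
by [].
Qed.

Fixpoint walks k x : seq (seq (vertex m)) :=
  if k is k'.+1 then flatten [seq [seq y :: p | p <- walks k' y] | y <- around 1 x]
  else [:: [::]].

Lemma mem_walks x p : path (@star m) x p -> p \in walks (size p) x.
Proof.
elim: p x => //= y p IHp x /andP[xy hp]; apply/flattenP.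
exists [seq y :: q | q <- walks (size p) y]; last by apply/map_f/IHp.
by apply/mapP; exists y => //; exact: mem_around.
Qed.

Lemma size_mem_walks k x p : p \in walks k x -> size p = k.
Proof.
elim: k x p => [x p|k IHk x p] /=; first by rewrite inE => /eqP ->.
by move=> /flattenP[_ /mapP[y _ ->] /mapP[q /IHk <- ->]].
Qed.

Lemma size_walks k x : (size (walks k x) <= (3 ^ m) ^ k)%N.
Proof.
elim: k x => //= k IHk x; rewrite size_flatten /shape -map_comp sumnE big_map.
apply: leq_trans (_ : \sum_(y <- around 1 x) (3 ^ m) ^ k <= _)%N.
  by apply: leq_sum => y _; rewrite /= size_map.
rewrite big_const_seq count_predT iter_addn_0 mulnC expnS leq_mul2r.
by rewrite size_map; apply/orP; right; have := card_box 1.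
Qed.

(** A decidable form of the absence of bad paths around [v]: a self-avoiding path in the box has
    fewer steps than the box has sites, so finitely many lengths suffice. *)
Definition good v (g : seq (vertex m)) : bool :=
  all (fun k => all (fun y => all (fun p => ~~ bad_path n (mem g) v y p) (walks k y))
    (around k.+1 v)) (iota 0 #|` B|).

Lemma goodP v g : good v g -> forall y p, ~~ bad_path n (mem g) v y p.
Proof.
move=> /allP h y p; apply/negP => hb; case/and4P: (hb) => hu hp /allP ha hc.
have /h /allP/(_ y) : size p \in iota 0 #|` B|.
  rewrite mem_iota add0n /=.
  have /(uniq_leq_size hu) : {subset y :: p <= enum_fset B} by move=> z /ha /andP[].
  by [].
rewrite mem_around; last by rewrite cubeC.
by move=> /(_ isT) /allP /(_ p (mem_walks hp)); rewrite hb.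
Qed.

Lemma good_increasing v : @increasing_obs R _ (fun g => (good v g)%:R).
Proof.
move=> g g' gg'; rewrite ler_nat; case hg: (good v g) => //.
suff -> : good v g' by [].
apply/allP => k _; apply/allP => y _; apply/allP => p _.
apply: contra (goodP hg y p) => /and4P[h1 h2 /allP h3 h4].
apply/and4P; split=> //; apply/allP => z /h3 /andP[zB zg]; rewrite zB /=.
by apply: contra zg; exact: gg'.
Qed.

Variable eps : R.
Hypothesis eps0 : 0 <= eps.
Hypothesis eps_small : 3 * 9 ^+ m * eps <= 1.

Lemma eps01 : 0 <= eps <= 1.
Proof.
rewrite eps0 /=; apply: le_trans eps_small; rewrite ler_peMl // mulr_ege1 ?exprn_ege1 //; lra.
Qed.

(** Union bound over bad paths with k steps: at most 3^(m(k+1)) starting points, 3^(mk) walks from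
    each, and probability at most eps^(k+1) that all sites are bad. The resulting geometric series
    has ratio 9^m eps <= 1/3 and sum at most 1/2. *)
Lemma perc_good v : 1 / 2 <= perc eps (enum_fset B) (fun g => (good v g)%:R) [::].
Proof.
(* Indicator that every site of the path is bad; its second factor does not depend on [g]. *)
pose bp (k : nat) y p (g : seq (vertex m)) : R := (all (fun z => z \notin g) (y :: p))%:R *
   (uniq (y :: p) && all (mem (enum_fset B)) (y :: p))%:R.
pose tot (f : nat -> vertex m -> seq (vertex m) -> R) :=
  \sum_(k <- iota 0 #|` B|) \sum_(y <- around k.+1 v) \sum_(p <- walks k y) f k y p.
have tot_ge0 g : 0 <= tot (fun k y p => bp k y p g).
  by do 3!apply: sumr_ge0 => ? _; rewrite mulr_ge0 ?ler0n.
have le1 g : 1 <= (good v g)%:R + tot (fun k y p => bp k y p g).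
  have [hg|/allPn[k hk /allPn[y hy /allPn[p hp]]]] := boolP (good v g).
    by rewrite lerDl tot_ge0.
  rewrite negbK => /and4P[h1 _ h3 _]; rewrite add0r /tot.
  rewrite (big_rem k) //= (big_rem y) //= (big_rem p) //=.
  rewrite -[leLHS]addr0 lerD //; last first.
    by do 3!apply: sumr_ge0 => ? _; rewrite mulr_ge0 ?ler0n.
  rewrite -[leLHS]addr0 lerD //; last first.
    by do 2!apply: sumr_ge0 => ? _; rewrite mulr_ge0 ?ler0n.
  rewrite -[leLHS]addr0 lerD //; last first.
    by apply: sumr_ge0 => ? _; rewrite mulr_ge0 ?ler0n.
  rewrite /bp -natrM mulnb ler1n lt0b h1.
  by move/allP: h3 => h3; apply/andP; split; apply/allP => z /h3 /andP[].
have bp_le k y p : p \in walks k y -> perc eps (enum_fset B) (bp k y p) [::] <= eps ^+ k.+1.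
  move=> /size_mem_walks sz; rewrite /bp; case: andP => [[hu /allP ha]|_].
    have := perc_closed eps01 [::] (fset_uniq B) hu.
    have -> : count (mem (enum_fset B)) (y :: p) = k.+1.
      rewrite -sz -[RHS]/(size (y :: p)) -count_predT; apply: eq_in_count => z /ha.
      by [].
    by apply: le_trans; apply: (perc_le eps01) => g; rewrite mulr1.
  apply: le_trans (_ : perc eps (enum_fset B) (fun=> 0) [::] <= _).
    by apply: (perc_le eps01) => g; rewrite mulr0.
  by rewrite perc_cst exprn_ge0.
suff tot_le : perc eps (enum_fset B) (fun g => tot (fun k y p => bp k y p g)) [::] <= 1 / 2.
  have := perc_le eps01 (enum_fset B) [::] le1; rewrite perc_cst percD.
  move: tot_le; lra.
rewrite /tot perc_sum.
have third : 0 <= 9 ^+ m * eps <= 1 / 3.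
  by rewrite mulr_ge0 ?exprn_ge0 //=; have := eps_small; rewrite -mulrA; lra.
apply: le_trans (_ : \sum_(k <- iota 0 #|` B|) (9 ^+ m * eps) ^+ k.+1 <= _).
  apply: ler_sum => k _; rewrite perc_sum.
  apply: le_trans (_ : \sum_(y <- around k.+1 v) ((3 ^ m) ^ k)%:R * eps ^+ k.+1 <= _).
    apply: ler_sum => y _; rewrite perc_sum.
    apply: le_trans (_ : \sum_(p <- walks k y) eps ^+ k.+1 <= _).
      by rewrite big_seq [leRHS]big_seq; apply: ler_sum => p; exact: bp_le.
    rewrite big_const_seq count_predT -Monoid.iteropE /= -[leLHS]mulr_natl.
    by rewrite ler_wpM2r ?exprn_ge0 // ler_nat size_walks.
  rewrite big_const_seq count_predT iter_addr_0 -[leLHS]mulr_natl mulrA -natrM exprMn.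
  rewrite ler_wpM2r ?exprn_ge0 // -!natrX ler_nat.
  apply: leq_trans (_ : (3 ^ k.+1) ^ m * (3 ^ m) ^ k <= _)%N.
    rewrite leq_mul2r size_map; apply/orP; right; apply: leq_trans (card_box _) _.
    have le3 : (k.+1.*2.+1 <= 3 ^ k.+1)%N.
      by elim: (k) => // k' IHk; rewrite expnS; lia.
    by case: (posnP m) => [->//|m0]; rewrite leq_exp2r.
  by rewrite -!expnM -expnD -[9%N]/(3 ^ 2)%N -expnM leq_exp2l //; nia.
move: third; move: (9 ^+ m * eps) => q /andP[q0 q3].
suff main K : \sum_(k <- iota 0 K) q ^+ k.+1 <= 1 / 2 - 1 / 2 * (1 / 3) ^+ K.
  by apply: le_trans (main _) _; rewrite lerBlDr lerDl mulr_ge0 ?exprn_ge0.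
elim: K => [|K IHK]; first by rewrite big_nil expr0; lra.
rewrite -addn1 iotaD add0n big_cat /= big_seq1 addn1.
have h3 : q ^+ K.+1 <= (1 / 3) ^+ K.+1 by rewrite lerXn2r ?nnegrE ?divr_ge0.
move: IHK h3; rewrite !exprS; move: ((1 / 3) ^+ K) (q ^+ K) => a b h h3; lra.
Qed.

End GoodSites.

(** * The finite-volume model *)

Lemma Z2P (g : 'Z_2) : g = 0 \/ g = 1.
Proof.
by case: g => -[|[|//]] h; [left|right]; apply: val_inj.
Qed.

Lemma Z2N (g : 'Z_2) : - g = g.
Proof. by case: (Z2P g) => ->; apply: val_inj. Qed.

Lemma Z2DD (g : 'Z_2) : g + g = 0.
Proof. by rewrite -[X in X + _]Z2N addNr. Qed.

Section Extension.
Variables (T : choiceType) (A : {fset oriented T}).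
Implicit Types (w : {ffun A -> 'Z_2}) (c : oriented T).

Lemma ext_in w c (h : c \in A) : ext w c = w [` h]%fset.
Proof. by rewrite /ext insubT. Qed.

Lemma ext_out w c : c \notin A -> ext w c = 0.
Proof. by move=> h; rewrite /ext insubN. Qed.

Lemma ext_finfun (f : A -> 'Z_2) c (h : c \in A) : ext (finfun f) c = f [` h]%fset.
Proof. by rewrite ext_in ffunE. Qed.

Lemma extD w w' c : ext (w + w') c = ext w c + ext w' c.
Proof.
have [h|h] := boolP (c \in A); first by rewrite !ext_in ffunE.
by rewrite !ext_out ?addr0.
Qed.

Lemma ext0 c : ext (0 : {ffun A -> 'Z_2}) c = 0.
Proof.
have [h|h] := boolP (c \in A); last by rewrite ext_out.
by rewrite ext_in ffunE.
Qed.

Lemma formP w : (forall c, (Defs.opp c \in A) = (c \in A)) ->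
  reflect (forall c, ext w (Defs.opp c) = ext w c) (Defs.form w).
Proof.
move=> hA; apply: (iffP forallP) => [h c|h c].
  have [hc|hc] := boolP (c \in A); last by rewrite !ext_out ?hA.
  by have /eqP := h [` hc]%fset; rewrite /= => ->; rewrite Z2N ext_in.
by rewrite Z2N -[w c](_ : ext w (val c) = _) ?h // (ext_in _ (valP c)); congr (w _); apply: val_inj.
Qed.

End Extension.

Lemma C1_opp m N (e : oriented (edge m)) : (Defs.opp e \in C1 m N) = (e \in C1 m N).
Proof. by rewrite !mem_C1 /esrc /etgt /Defs.opp /=; case: e.1 => /=; rewrite andbC. Qed.

Lemma C0_opp m N (x : oriented (vertex m)) : (Defs.opp x \in C0 m N) = (x \in C0 m N).
Proof. by rewrite !mem_C0. Qed.

(** Gauge and Higgs fields together form one finite group of exponent two, in which the pairs of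
    forms are a subgroup. *)
Definition config m N := ({ffun C1 m N -> 'Z_2} * {ffun C0 m N -> 'Z_2})%type.
HB.instance Definition _ m N := Finite.on (config m N).
HB.instance Definition _ m N := GRing.Zmodule.on (config m N).

Section Configurations.
Variables (m N : nat).
Implicit Types (c : config m N).

Definition forms : {pred config m N} := [pred c | Defs.form c.1 && Defs.form c.2].

Lemma formsP c : reflect ((forall e, ext c.1 (Defs.opp e) = ext c.1 e) /\
  (forall x, ext c.2 (Defs.opp x) = ext c.2 x)) (c \in forms).
Proof.
apply: (iffP andP) => -[h1 h2]; split.
- exact/formP/h1/C1_opp.
- exact/formP/h2/C0_opp.
- by apply/formP => //; exact: C1_opp.
- by apply/formP => //; exact: C0_opp.
Qed.

Lemma config_addVV c : c + c = 0.
Proof. by case: c => s phi; congr pair; apply/ffunP => x; rewrite !ffunE Z2DD. Qed.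

Lemma forms0 : 0 \in forms.
Proof. by apply/formsP; split=> x; rewrite !ext0. Qed.

Lemma formsD c c' : c \in forms -> c' \in forms -> c + c' \in forms.
Proof.
move=> /formsP[h1 h2] /formsP[h1' h2']; apply/formsP.
by split=> x; rewrite !extD ?h1 ?h1' ?h2 ?h2'.
Qed.

End Configurations.

Section Characters.
Variables (R : realType) (m : nat).
Implicit Types (e : edge m) (l : seq (edge m)) (p : plaquette m).

Lemma repr_Z2D (g h : 'Z_2) : repr_Z2 R (g + h) = repr_Z2 R g * repr_Z2 R h.
Proof.
rewrite /repr_Z2; case: (Z2P g) => ->; case: (Z2P h) => ->;
  rewrite /= ?expr0 ?expr1 ?mulr1 ?mul1r ?mulrNN ?mulr1 //.
Qed.

Lemma repr_Z2_0 : repr_Z2 R 0 = 1. Proof. exact: expr0. Qed.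

Definition link e (s : oriented (edge m) -> 'Z_2) (phi : oriented (vertex m) -> 'Z_2) : R :=
  repr_Z2 R (s (false, e) - d0 phi (false, e)).

(** Signs are irrelevant modulo 2, so a Wilson line is encoded by a list of unoriented edges, in
    which two occurrences of an edge cancel. *)
Definition line l s phi : R := \prod_(e <- l) link e s phi.

Lemma line_cat l l' s phi : line (l ++ l') s phi = line l s phi * line l' s phi.
Proof. exact: big_cat. Qed.

Section Box.
Variable (N : nat).
Implicit Types (c : config m N).

Definition obs (f : (oriented (edge m) -> 'Z_2) -> (oriented (vertex m) -> 'Z_2) -> R) c :=
  f (ext c.1) (ext c.2).

Definition plaq p c := repr_Z2 R (d1 (ext c.1) p).

Definition olink (e : oriented (edge m)) c :=
  repr_Z2 R (ext c.1 e - d0 (ext c.2) e).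

Lemma plaq_character p : character (plaq p).
Proof.
case: p => [[x i] j]; split=> [|c c']; rewrite /plaq /d1 !big_cons !big_nil.
  by rewrite !ext0 !addr0 repr_Z2_0.
by rewrite -repr_Z2D !extD !addr0; congr (repr_Z2 R _); ring.
Qed.

Lemma olink_character (a : oriented (edge m)) : character (olink a).
Proof.
split=> [|c c']; rewrite /olink /d0; first by rewrite !ext0 !subr0 repr_Z2_0.
by rewrite -repr_Z2D !extD; congr (repr_Z2 R _); ring.
Qed.

Lemma line_character l : character (obs (line l)).
Proof.
elim: l => [|e l IHl]; first by split=> [|c c']; rewrite /obs /line !big_nil ?mulr1.
have -> : obs (line (e :: l)) = fun c => olink (false, e) c * obs (line l) c.
  by apply/funext => c; rewrite /obs /line big_cons.
by apply: characterM => //; exact: olink_character.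
Qed.

Lemma olinkE (e : oriented (edge m)) c : c \in @forms m N -> olink e c = obs (line [:: e.2]) c.
Proof.
move=> /formsP[h1 h2]; rewrite /obs /line big_seq1 /link /olink.
case: e => -[] e //=; rewrite -[(true, e)]/(Defs.opp (false, e)) h1 /d0 /=.
by rewrite -[X in _ - X]Z2N opprB.
Qed.

Variables (beta kappa : R).

Definition weight c := gibbs_weight beta kappa c.1 c.2.

Lemma expectationE f : Defs.expectation beta kappa N f = avg (@forms m N) weight (obs f).
Proof.
rewrite /Defs.expectation /avg /gsum mulr_suml.
rewrite [RHS](eq_bigl (fun c : config m N => (Omega1 m N c.1) && (Omega0 m N c.2))) //.
rewrite pair_big /=; apply: eq_bigr => c _; rewrite -mulrA; congr (_ * (_ / _)).
by rewrite /partition_function pair_big.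
Qed.

End Box.

(** Hyperbolic cosine, followed by the hyperbolic sine. For a sign s, exp(J s) = cosh J + s sinh J
    puts a Gibbs factor in the form [a + b * chi], with [0 <= b <= a] if [0 <= J]. *)
Definition ch (J : R) : R := (expR J + expR (- J)) / 2.
Definition sh (J : R) : R := (expR J - expR (- J)) / 2.

Lemma ch_gt0 J : 0 < ch J.
Proof. by rewrite divr_gt0 // addr_gt0 // expR_gt0. Qed.

Lemma sh_ch J : 0 <= J -> 0 <= sh J <= ch J.
Proof.
move=> J0; have := expR_gt0 (- J); have : expR (- J) <= expR J by rewrite ler_expR; lra.
by rewrite /sh /ch; lra.
Qed.

Lemma expR_repr J g : expR (J * repr_Z2 R g) = ch J + sh J * repr_Z2 R g.
Proof.
by rewrite /ch /sh /repr_Z2; case: (Z2P g) => -> /=; rewrite ?expr0 ?expr1 ?mulr1 ?mulrN1; field.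
Qed.

(** The Gibbs weight with couplings only on [P] and [E], so that dropping couplings means passing to
    sublists. The leading 1 is the trivial weight from which the product lemmas start. *)
Definition prod_weight N J K (P : seq (plaquette m)) (E : seq (oriented (edge m)))
    (c : config m N) : R :=
  1 * (\prod_(p <- P) (ch J + sh J * plaq p c)) * \prod_(e <- E) (ch K + sh K * olink e c).

Lemma weightE N beta kappa : @weight N beta kappa = prod_weight beta kappa (C2 m N) (C1 m N).
Proof.
apply/funext => c; rewrite /weight /gibbs_weight /prod_weight mul1r expRD !mulr_sumr !expR_sum.
by congr (_ * _); apply: eq_bigr => ? _; rewrite expR_repr.
Qed.

Lemma prod_weight_ferromagnetic N J K P E : 0 <= J -> 0 <= K ->
  ferromagnetic (@forms m N) (prod_weight J K P E).
Proof.
move=> J0 K0; apply: (ferromagnetic_prod (@config_addVV m N)) => [_|_|k|].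
- exact: ch_gt0.
- exact: sh_ch.
- exact: olink_character.
apply: (ferromagnetic_prod (@config_addVV m N)) => [_|_|k|].
- exact: ch_gt0.
- exact: sh_ch.
- exact: plaq_character.
exact: ferromagnetic1 (@config_addVV m N) (@forms0 m N) (@formsD m N).
Qed.

End Characters.

(** * Comparison with independent projectors *)

Section Decoupling.
Variables (R : realFieldType) (V : finZmodType) (G : {pred V}).
Hypothesis addVV : forall x : V, x + x = 0.
Hypothesis G0 : 0 \in G.
Hypothesis GD : forall x y, x \in G -> y \in G -> x + y \in G.
Variables (X : eqType) (I : Type) (D : seq I) (chi : X -> I -> V -> R) (a b : R).
Hypothesis chiP : forall x k, character (chi x k).
Hypothesis a0 : 0 < a.
Hypothesis hba : 0 <= b <= a.
Variable psi : V -> R.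
Hypothesis psiP : character psi.
Implicit Types (w : V -> R) (l g : seq X).

Lemma ferromagnetic_proj (J : Type) (chi' : J -> V -> R) (s : seq J) w :
  (forall k, character (chi' k)) -> ferromagnetic G w ->
  ferromagnetic G (fun c => w c * \prod_(k <- s) (1 + chi' k c)).
Proof.
move=> hchi hw; have h11 (k : J) : 0 <= (1 : R) <= (1 : R) by rewrite ler01 lexx.
have := @ferromagnetic_prod _ _ G addVV _ (fun=> 1) (fun=> 1) chi' s w
  (fun=> ltr01) h11 hchi hw.
by apply: eq_ferromagnetic => c; congr (_ * _); apply: eq_bigr => k _; rewrite mul1r.
Qed.

Lemma avg_proj (J : Type) (chi' : J -> V -> R) (s : seq J) w :
  (forall k, character (chi' k)) -> ferromagnetic G w ->
  avg G w psi <= avg G (fun c => w c * \prod_(k <- s) (1 + chi' k c)) psi.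
Proof.
move=> hchi hw; have h11 (k : J) : 0 <= (1 : R) <= (1 : R) by rewrite ler01 lexx.
have := @avg_prod _ _ G addVV GD _ (fun=> 1) (fun=> 1) chi' s w _
  (fun=> ltr01) h11 hchi hw psiP.
have -> // : (fun c => w c * \prod_(k <- s) (1 + 1 * chi' k c)) =
  (fun c => w c * \prod_(k <- s) (1 + chi' k c)).
by apply/funext => c; congr (_ * _); apply: eq_bigr => k _; rewrite mul1r.
Qed.

(** Each factor becomes a projector with probability [b / a]. Outcomes with only some projectors are
    bounded below by the average with none, which leaves all or nothing. *)
Lemma avg_mixture_prod x (s : seq I) w : ferromagnetic G w ->
  (1 - (b / a) ^+ size s) * avg G w psi
   + (b / a) ^+ size s * avg G (fun c => w c * \prod_(k <- s) (1 + chi x k c)) psi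
  <= avg G (fun c => w c * \prod_(k <- s) (a + b * chi x k c)) psi.
Proof.
have t01 : 0 <= b / a <= 1.
  by case/andP: hba => b0 ba; rewrite divr_ge0 ?(ltW a0) // ler_pdivrMr ?mul1r.
elim: s w => [|k s IHs] w hw.
  have -> : (fun c => w c * \prod_(k <- [::]) (a + b * chi x k c)) = w.
    by apply/funext => c; rewrite big_nil mulr1.
  have -> : (fun c => w c * \prod_(k <- [::]) (1 + chi x k c)) = w.
    by apply/funext => c; rewrite big_nil mulr1.
  by rewrite expr0 subrr mul0r add0r mul1r.
have hwk := ferromagnetic_factor addVV a0 hba (chiP x k) hw.
have -> : (fun c => w c * \prod_(j <- k :: s) (a + b * chi x j c)) =
    (fun c => w c * (a + b * chi x k c) * \prod_(j <- s) (a + b * chi x j c)).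
  by apply/funext => c; rewrite big_cons mulrA.
apply: le_trans (IHs _ hwk).
have hws := ferromagnetic_proj s (chiP x) hw.
have h1 := avg_factor addVV GD a0 hba hw (chiP x k) psiP.
have h2 := avg_mixture addVV GD a0 hba hws (chiP x k) psiP.
have h3 := avg_proj s (chiP x) hw.
have -> : (fun c => w c * \prod_(j <- k :: s) (1 + chi x j c)) =
    (fun c => w c * (\prod_(j <- s) (1 + chi x j c)) * (1 + chi x k c)).
  by apply/funext => c; rewrite big_cons; ring.
have -> : (fun c => w c * (a + b * chi x k c) * \prod_(j <- s) (1 + chi x j c)) =
    (fun c => w c * (\prod_(j <- s) (1 + chi x j c)) * (a + b * chi x k c)).
  by apply/funext => c; ring.
move: h1 h2 h3; set A := avg G w psi; set B := avg G _ psi; set C := avg G _ psi.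
set E := avg G _ psi; set F := avg G _ psi.
case/andP: t01 => t0 t1; rewrite /= exprS.
have := exprn_ile1 (size s) t0 t1; have := exprn_ge0 (size s) t0.
move: (b / a) t0 t1 ((b / a) ^+ size s) => t t0 t1 q q0 q1 h1 h2 h3.
have hF : (1 - t) * A + t * E <= F.
  by apply: le_trans h2; rewrite lerD2r ler_wpM2l ?subr_ge0.
apply: le_trans (_ : (1 - q) * A + q * ((1 - t) * A + t * E) <= _).
  by rewrite le_eqVlt; apply/orP; left; apply/eqP; ring.
by rewrite lerD // ler_wpM2l ?subr_ge0.
Qed.

(** Proportional to the indicator that [chi x k c = 1] for all [x] in [g] and [k] in [D]. *)
Definition proj_weight g (c : V) : R := 1 * \prod_(x <- g) \prod_(k <- D) (1 + chi x k c).

Lemma proj_weight_ferromagnetic g : ferromagnetic G (proj_weight g).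
Proof.
elim: g => [|x g IHg].
  by apply: eq_ferromagnetic (ferromagnetic1 R addVV G0 GD) => c; rewrite /proj_weight big_nil mulr1.
apply: eq_ferromagnetic (ferromagnetic_proj D (chiP x) IHg) => c.
by rewrite /proj_weight big_cons; ring.
Qed.

(** Treating the sites one by one makes each site of [l] a projector, independently, with
    probability [(b / a) ^+ size D]: a percolation of flat sites. *)
Lemma perc_le_avg l g :
  perc (1 - (b / a) ^+ size D) l (fun g => avg G (proj_weight g) psi) g <=
  avg G (fun c => proj_weight g c * \prod_(x <- l) \prod_(k <- D) (a + b * chi x k c)) psi.
Proof.
have fer l' g' : ferromagnetic G
   (fun c => proj_weight g' c * \prod_(x <- l') \prod_(k <- D) (a + b * chi x k c)).
  elim: l' => [|x l' IHl].
    by apply: eq_ferromagnetic (proj_weight_ferromagnetic g') => c; rewrite big_nil mulr1.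
  have := @ferromagnetic_prod _ _ G addVV _ (fun=> a) (fun=> b) (chi x) D _
    (fun=> a0) (fun=> hba) (chiP x) IHl.
  by apply: eq_ferromagnetic => c; rewrite big_cons; ring.
elim: l g => [|x l IHl] g /=.
  have -> // : (fun c => proj_weight g c * \prod_(x <- [::]) \prod_(k <- D) (a + b * chi x k c))
    = proj_weight g by apply/funext => c; rewrite big_nil mulr1.
have := avg_mixture_prod x D (fer l g).
have -> : (fun c => proj_weight g c * \prod_(y <- x :: l) \prod_(k <- D) (a + b * chi y k c)) =
   (fun c => proj_weight g c * \prod_(y <- l) \prod_(k <- D) (a + b * chi y k c)
      * \prod_(k <- D) (a + b * chi x k c)).
  by apply/funext => c; rewrite big_cons; ring.
apply: le_trans; have t01 : 0 <= b / a <= 1.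
  by case/andP: hba => b0 ba; rewrite divr_ge0 ?(ltW a0) // ler_pdivrMr ?mul1r.
case/andP: t01 => t0 t1.
rewrite lerD //.
  by rewrite ler_wpM2l ?subr_ge0 ?exprn_ile1.
rewrite opprB addrC subrK ler_wpM2l ?exprn_ge0 //; apply: le_trans (IHl _) _.
rewrite le_eqVlt; apply/orP; left; apply/eqP; congr (avg G _ psi).
by apply/funext => c; rewrite /proj_weight big_cons; ring.
Qed.

End Decoupling.

(** * Monotonicity in the box and in the set of couplings *)

Section Transport.
Variable m : nat.
Implicit Types N : nat.

Definition transport N N' (c : config m N) : config m N' :=
  ([ffun e => ext c.1 (val e)], [ffun x => ext c.2 (val x)]).

Lemma ext_transport1 N N' (c : config m N) e :
  ext (transport N' c).1 e = if e \in C1 m N' then ext c.1 e else 0.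
Proof. by case: ifPn => h; [rewrite ext_finfun|rewrite ext_out]. Qed.

Lemma ext_transport2 N N' (c : config m N) x :
  ext (transport N' c).2 x = if x \in C0 m N' then ext c.2 x else 0.
Proof. by case: ifPn => h; [rewrite ext_finfun|rewrite ext_out]. Qed.

Lemma transportD N N' (c c' : config m N) :
  transport N' (c + c') = transport N' c + transport N' c'.
Proof. by congr pair; apply/ffunP => x; rewrite !ffunE extD. Qed.

Lemma transport_forms N N' (c : config m N) : c \in @forms m N -> transport N' c \in @forms m N'.
Proof.
move=> /formsP[h1 h2]; apply/formsP; split=> x.
  by rewrite !ext_transport1 C1_opp h1.
by rewrite !ext_transport2 C0_opp h2.
Qed.

Lemma box_sub N N' : (N <= N')%N -> {subset box m N <= box m N'}.
Proof. by move=> h x; rewrite -!cube0; exact: cubeS. Qed.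

Lemma C1_sub N N' : (N <= N')%N -> {subset C1 m N <= C1 m N'}.
Proof. by move=> h e; rewrite !mem_C1 => /andP[/(box_sub h) -> /(box_sub h)]. Qed.

Lemma C0_sub N N' : (N <= N')%N -> {subset C0 m N <= C0 m N'}.
Proof. by move=> h x; rewrite !mem_C0; exact: box_sub. Qed.

Lemma C2_sub N N' : (N <= N')%N -> {subset C2 m N <= C2 m N'}.
Proof.
move=> h p; rewrite !mem_C2 => /andP[-> /allP hp]; apply/allP => x /hp.
exact: box_sub.
Qed.

Lemma transportK N N' (c : config m N) : (N <= N')%N ->
  transport N (transport N' c) = c.
Proof.
move=> h; rewrite [RHS]surjective_pairing; congr pair; apply/ffunP => x; rewrite ffunE.
  rewrite ext_transport1 (C1_sub h (valP x)) (ext_in _ (valP x)).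
  by congr (c.1 _); apply: val_inj.
rewrite ext_transport2 (C0_sub h (valP x)) (ext_in _ (valP x)).
by congr (c.2 _); apply: val_inj.
Qed.

Variable R : realType.

Lemma gsum_transport N N' : (N <= N')%N -> exists2 K : R, 0 < K &
  forall f : config m N -> R,
    gsum (@forms m N') (fun c => f (transport N c)) = K * gsum (@forms m N) f.
Proof.
move=> h; pose ker := [pred c : config m N' | (c \in @forms m N') && (transport N c == 0)].
have tr0 : transport N (0 : config m N') = 0.
  by rewrite -(config_addVV 0) transportD config_addVV.
exists (\sum_(c | ker c) 1) => [|f].
  by rewrite (bigD1 0) /= ?ltr_wpDr ?sumr_ge0 ?forms0 ?tr0 ?eqxx.
rewrite /gsum (partition_big (transport N) (fun c => c \in @forms m N)) /=; last first.
  by move=> c; exact: transport_forms.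
rewrite mulr_sumr; apply: eq_bigr => c cG.
rewrite (eq_bigr (fun=> f c)) => [|c' /andP[_ /eqP -> //]].
rewrite -[X in \sum_(_ | _) X]mul1r -mulr_suml; congr (_ * _).
pose sh c' := c' + transport N' c.
have shK : involutive sh by move=> c'; rewrite /sh -addrA config_addVV addr0.
rewrite (reindex_inj (inv_inj shK)) /=; apply: eq_bigl => c'.
rewrite /sh transportD transportK // -[X in _ == X]add0r (inj_eq (addIr c)).
congr (_ && _); apply/idP/idP => [hc|/formsD]; last by apply; exact: transport_forms.
by rewrite -(shK c') /sh; apply: formsD => //; exact: transport_forms.
Qed.

Lemma avg_transport N N' (w f : config m N -> R) : (N <= N')%N ->
  avg (@forms m N') (fun c => w (transport N c)) (fun c => f (transport N c)) =
  avg (@forms m N) w f.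
Proof.
move=> h; have [K K0 hK] := gsum_transport h.
rewrite /avg (hK (fun c => f c * w c)) (hK w).
by rewrite invfM mulrACA divff ?gt_eqF // mul1r.
Qed.

Lemma prod_weight_transport N N' (J K : R) P E (c : config m N') :
  {subset P <= C2 m N} -> {subset E <= C1 m N} ->
  @prod_weight R m N' J K P E c = prod_weight J K P E (transport N c).
Proof.
move=> hP hE; rewrite /prod_weight; congr (1 * _ * _).
  rewrite !big_seq; apply: eq_bigr => -[[x i] j] /hP; rewrite mem_C2 /= => /andP[_ /and5P[h1 h2 h3 h4 _]].
  rewrite /plaq /d1 !big_cons !big_nil !ext_transport1 !mem_C1 /esrc /etgt /=.
  by rewrite [x + _ + unit_vec i]addrAC; move: h1 h2 h3 h4 => /= -> -> -> ->.
rewrite !big_seq; apply: eq_bigr => e /hE he.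
rewrite /olink /d0 !ext_transport1 !ext_transport2 !mem_C0 /= he.
by move: he; rewrite mem_C1 => /andP[-> ->].
Qed.

Definition edge_in N (e : edge m) := (e.1 \in box m N) && (e.1 + unit_vec e.2 \in box m N).

Lemma line_transport N N' l (c : config m N') : all (edge_in N) l ->
  obs (line R l) c = obs (line R l) (transport N c).
Proof.
move=> /allP hl; rewrite /obs /line !big_seq; apply: eq_bigr => e /hl /andP[h1 h2].
rewrite /link /d0 ext_transport1 !ext_transport2 !mem_C0 mem_C1 /esrc /etgt /=.
by rewrite h1 h2.
Qed.

Lemma prod_weight_sub N (J K : R) P P' E E' psi : 0 <= J -> 0 <= K ->
  uniq P -> uniq P' -> {subset P <= P'} -> uniq E -> uniq E' -> {subset E <= E'} ->
  character psi ->
  avg (@forms m N) (@prod_weight R m N J K P E) psi <=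
  avg (@forms m N) (@prod_weight R m N J K P' E') psi.
Proof.
move=> J0 K0 uP uP' PP' uE uE' EE' hpsi.
have perm_sub (T : eqType) (s s' : seq T) : uniq s -> uniq s' -> {subset s <= s'} ->
    perm_eq s' (s ++ [seq x <- s' | predC (mem s) x]).
  move=> us us' ss'; apply: uniq_perm => // [|x].
    rewrite cat_uniq us filter_uniq // andbT -all_predC; apply/allP => x.
    by rewrite mem_filter => /andP[].
  by rewrite mem_cat mem_filter /=; case xs: (x \in s) => //=; rewrite ss'.
have -> : @prod_weight R m N J K P' E' = fun c => prod_weight J K P E c
   * (\prod_(p <- [seq x <- P' | predC (mem P) x]) (ch J + sh J * plaq R p c))
   * (\prod_(e <- [seq x <- E' | predC (mem E) x]) (ch K + sh K * olink R e c)).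
  apply/funext => c; rewrite /prod_weight (perm_big _ (perm_sub _ _ _ uP uP' PP')) /=.
  by rewrite (perm_big _ (perm_sub _ _ _ uE uE' EE')) /= !big_cat /=; ring.
have fer := @prod_weight_ferromagnetic R m N J K P E J0 K0.
apply: le_trans (avg_prod (@config_addVV m N) (@formsD m N) _ _ _ _ _ hpsi).
- by apply: (avg_prod (@config_addVV m N) (@formsD m N)) => // *;
    rewrite ?ch_gt0 ?sh_ch //; exact: plaq_character.
- by move=> _; exact: ch_gt0.
- by move=> _; exact: sh_ch.
- by move=> e; exact: olink_character.
- by apply: (ferromagnetic_prod (@config_addVV m N)) => // *;
    rewrite ?ch_gt0 ?sh_ch //; exact: plaq_character.
Qed.

Lemma prod_weight_le_expectation N N' (beta kappa : R) P E l : 0 <= beta -> 0 <= kappa ->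
  (N <= N')%N -> uniq P -> {subset P <= C2 m N} -> uniq E -> {subset E <= C1 m N} ->
  all (edge_in N) l ->
  avg (@forms m N) (@prod_weight R m N beta kappa P E) (obs (line R l)) <=
  Defs.expectation beta kappa N' (line R l).
Proof.
move=> b0 k0 NN' uP hP uE hE hl; rewrite expectationE weightE -(avg_transport _ _ NN').
have -> : (fun c : config m N' => obs (line R l) (transport N c)) = obs (line R l).
  by apply/funext => c; rewrite -line_transport.
have -> : (fun c : config m N' => prod_weight beta kappa P E (transport N c)) =
    prod_weight beta kappa P E.
  by apply/funext => c; rewrite -prod_weight_transport.
apply: prod_weight_sub => //; rewrite ?fset_uniq //.
- by move=> p /hP; apply: C2_sub.
- by move=> e /hE; apply: C1_sub.
- exact: line_character.
Qed.

Lemma expectation_mono N N' (beta kappa : R) l : 0 <= beta -> 0 <= kappa -> (N <= N')%N ->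
  all (edge_in N) l ->
  Defs.expectation beta kappa N (line R l) <= Defs.expectation beta kappa N' (line R l).
Proof.
move=> b0 k0 NN' hl; rewrite [leLHS]expectationE weightE.
by apply: prod_weight_le_expectation; rewrite ?fset_uniq.
Qed.

End Transport.

(** * Closed lines *)

Section PerimeterLaw.
Variables (R : realType) (m : nat).
Hypothesis hm : (3 <= m)%N.
Variables (beta kappa : R).
Hypothesis beta0 : 0 <= beta.
Hypothesis kappa0 : 0 <= kappa.

(** Both orders of a pair occur, as [C2] contains both orientations of a plaquette. *)
Definition dirs : seq ('I_m * 'I_m) := [seq ij <- enum {: 'I_m * 'I_m} | ij.1 != ij.2].

Lemma size_dirs : (size dirs <= m ^ 2)%N.
Proof.
rewrite size_filter; apply: leq_trans (count_size _ _) _.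
by rewrite -cardE card_prod card_ord.
Qed.

Definition at_site (x : vertex m) (ij : 'I_m * 'I_m) : plaquette m := (x, ij.1, ij.2).

Lemma at_site_C2 n x ij : x \in box m n.+1 -> ij \in dirs -> at_site x ij \in C2 m n.+2.
Proof.
rewrite mem_filter mem_C2 /at_site => hx /andP[hij _]; rewrite /= hij /=.
have hx0 : cube 0 n.+1 x by rewrite cube0.
have h1 k : cube 0 n.+2 (x + unit_vec k).
  by rewrite -[n.+2]addn1; apply: (cube_trans hx0); exact: cube_shift.
rewrite -!cube0; apply/and5P; split=> //; first exact: cubeS hx0.
apply/forallP => k; have /forallP/(_ k) := hx0; rewrite !shiftE.
move: hij; case: (eqVneq k ij.1) => [->|_]; case: eqVneq => //= _ _; rewrite mxE; lia.
Qed.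

(** If all base points are good, the gauge field along the line is the gradient of a single
    function, and a closed line sums gradients to 0. *)
Lemma closed_line_eq1 n g (l : seq (edge m)) (c : config m n.+2) M :
  (3 * M <= n)%N -> (forall e, e \in l -> e.1 \in box m M) ->
  (forall th : vertex m -> 'Z_2, \sum_(e <- l) pdiff e.2 th e.1 = 0) ->
  all (fun e => good n e.1 g) l ->
  (forall x ij, x \in g -> ij \in dirs -> plaq R (at_site x ij) c = 1) ->
  c \in @forms m n.+2 -> obs (line R l) c = 1.
Proof.
move=> Mn lM lcl /allP lgood gflat /formsP[c1 c2].
pose s (x : vertex m) (i : 'I_m) := ext c.1 (false, (x, i)).
have flat x i j : x \in box m n.+1 -> x \in mem g ->
    pdiff i (s^~ j) x - pdiff j (s^~ i) x = 0.
  move=> _ xg; have [->|ij] := eqVneq i j; first by rewrite subrr.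
  have := gflat x (i, j) xg; rewrite mem_filter ij mem_enum => /(_ isT).
  rewrite /plaq /d1 /= !big_cons big_nil addr0.
  rewrite -[(true, (x + _, i))]/(Defs.opp (false, (x + unit_vec j, i))).
  rewrite -[(true, (x, j))]/(Defs.opp (false, (x, j))) !c1.
  rewrite -[X in _ + (_ + (X + _))]Z2N -[X in _ + (_ + (_ + X))]Z2N => h.
  rewrite /pdiff /s; move: h; set g0 := (X in repr_Z2 R X).
  have key : repr_Z2 R g0 = 1 -> g0 = 0.
    case: (Z2P g0) => // ->; rewrite /repr_Z2 /= expr1 => h.
    by exfalso; lra.
  by move=> /key h; rewrite -h /g0; ring.
have [th hth] := flat_potential hm flat Mn lM (fun e he => goodP (lgood e he)).
rewrite /obs /line.
transitivity (repr_Z2 R (\sum_(e <- l) pdiff e.2 (fun x => th x - ext c.2 (false, x)) e.1)).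
  rewrite (big_morph (repr_Z2 R) (@repr_Z2D R) (repr_Z2_0 R)) !big_seq.
  apply: eq_bigr => e he; rewrite /link /d0 /etgt /esrc /=.
  have := hth e he; rewrite /s -surjective_pairing => ->.
  by congr (repr_Z2 R _); rewrite /pdiff; ring.
by rewrite lcl repr_Z2_0.
Qed.

Hypothesis beta_large : 3 * 9 ^+ m * (1 - (sh beta / ch beta) ^+ size dirs) <= 1.

(** Keep only the plaquettes based in [box m n.+1], group them by site and compare with a
    percolation of flat sites. If all base points of the line are good its average is 1; by Harris'
    inequality this happens with probability at least 2^(-|l|). *)
Lemma closed_line_ge n N M (l : seq (edge m)) :
  (3 * M <= n)%N -> (n.+2 <= N)%N -> (forall e, e \in l -> e.1 \in box m M) ->
  (forall th : vertex m -> 'Z_2, \sum_(e <- l) pdiff e.2 th e.1 = 0) ->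
  (1 / 2) ^+ size l <= Defs.expectation beta kappa N (line R l).
Proof.
move=> Mn nN lM lcl.
have hba := sh_ch beta0; have a0 := ch_gt0 beta.
pose B := enum_fset (box m n.+1).
pose P := [seq at_site x ij | x <- B, ij <- dirs].
have Pcl p : p \in P -> p \in C2 m n.+2.
  by case/allpairsP => -[x ij] /= [hx hij ->]; apply: at_site_C2.
have uP : uniq P.
  apply: allpairs_uniq; first exact: fset_uniq.
    by apply: filter_uniq; exact: enum_uniq.
  by move=> [x [i j]] [x' [i' j']] _ _ /= [-> -> ->].
have lin : all (edge_in n.+2) l.
  apply/allP => e /lM he; have h1 : e.1 \in box m n.+1 by apply: box_sub he; lia.
  apply/andP; split; first by apply: box_sub h1.
  by rewrite -cube0 -[n.+2]addn1; apply: (@cube_trans _ e.1); rewrite ?cube0 ?cube_shift.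
apply: le_trans (prod_weight_le_expectation beta0 kappa0 nN uP Pcl (E := [::]) _ _ lin) => //.
pose chi x ij := @plaq R m n.+2 (at_site x ij).
have chiP x ij : character (chi x ij) by exact: plaq_character.
have -> : @prod_weight R m n.+2 beta kappa P [::] = fun c => proj_weight dirs chi [::] c *
    \prod_(x <- B) \prod_(ij <- dirs) (ch beta + sh beta * chi x ij c).
  apply/funext => c; rewrite /prod_weight /proj_weight !big_nil !mulr1 !mul1r.
  by rewrite big_allpairs_dep.
apply: le_trans (perc_le_avg (@config_addVV m _) (@forms0 m _) (@formsD m _)
  dirs chiP a0 hba (line_character _ _ _) B [::]).
have t01 : 0 <= sh beta / ch beta <= 1.
  by case/andP: hba => b0 ba; rewrite divr_ge0 ?(ltW a0) // ler_pdivrMr ?mul1r.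
case/andP: t01 => t0 t1.
set eps := 1 - _; have eps0 : 0 <= eps by rewrite subr_ge0 exprn_ile1.
have eps1 := eps01 eps0 beta_large.
apply: le_trans (_ : perc eps B (fun g => (all (fun e => good n e.1 g) l)%:R) [::] <= _).
  apply: (@perc_harris_all _ _ _ eps1 _ B l (fun e g => good n e.1 g) [::] (1 / 2)).
  - by rewrite divr_ge0.
  - by move=> e; exact: good_increasing.
  - by move=> e; exact: perc_good.
apply: (perc_le eps1) => g; have fer := proj_weight_ferromagnetic (@config_addVV m n.+2)
  (@forms0 m _) (@formsD m _) dirs chiP g.
case: (boolP (all (fun e => good n e.1 g) l)) => hg /=; last by apply: avg_ge0 fer _; exact: line_character.
have -> // : avg (@forms m n.+2) (proj_weight dirs chi g) (obs (line R l)) = 1.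
case: fer => fer0 _ _.
rewrite /avg (eq_gsum (f' := proj_weight dirs chi g)) ?divff ?gt_eqF // => c cG.
(* A configuration that is not flat on [g] is killed by one of the projectors. *)
have [hall|hN] := boolP (all (fun x => all (fun ij => chi x ij c == 1) dirs) g).
  rewrite (@closed_line_eq1 n g l c M) ?mul1r // => x ij xg hij.
  by have /allP/(_ _ xg)/allP/(_ _ hij)/eqP := hall.
have -> : proj_weight dirs chi g c = 0; last by rewrite mulr0.
case/allPn: hN => x xg /allPn[ij hij h1]; rewrite /proj_weight mul1r.
rewrite (big_rem x xg) /= (big_rem ij hij) /=.
case: (character_pm (@config_addVV m n.+2) c (chiP x ij)) => hc.
  by rewrite hc eqxx in h1.
by rewrite hc subrr !mul0r.
Qed.

End PerimeterLaw.

Lemma ler_sum_subset (R : realDomainType) (T : eqType) (s s' : seq T) (F : T -> R) :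
  uniq s -> {subset s <= s'} -> (forall x, 0 <= F x) ->
  \sum_(x <- s) F x <= \sum_(x <- s') F x.
Proof.
move=> + + F0; elim: s s' => [|x s IHs] s' /=; first by rewrite big_nil sumr_ge0.
case/andP=> xs us ss'; rewrite big_cons [leRHS](big_rem x) ?ss' ?mem_head //= lerD2l.
apply: IHs => // y ys; apply: rem_mem; last by rewrite ss' // inE ys orbT.
by apply: contraNneq xs => <-.
Qed.

(** * Open lines *)

Section OddStep.
Variables (R : realType) (m : nat).
Implicit Types (x y z : vertex m) (l : seq (edge m)) (e : edge m).

Definition bsum l (th : vertex m -> 'Z_2) : 'Z_2 := \sum_(e <- l) pdiff e.2 th e.1.

(** The boundary of [l] modulo 2 is [x + y], tested against all functions on vertices; for [x = y]
    the line is closed. *)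
Definition ends l x y := forall th, bsum l th = th x + th y.

Lemma ends_cat l l' x y z : ends l x y -> ends l' x z -> ends (l ++ l') z y.
Proof.
move=> h h' th; rewrite /bsum big_cat /= -!/(bsum _ _) h h'.
by rewrite -[RHS]add0r -(Z2DD (th x)); ring.
Qed.

Definition star_edges z : seq (edge m) :=
  [seq (z, k) | k <- enum 'I_m] ++ [seq (z - unit_vec k, k) | k <- enum 'I_m].

Lemma star_edgesP z e : e \in star_edges z ->
  exists2 z', ends [:: e] z z' & forall k, `|z' 0 k - z 0 k| <= 1.
Proof.
rewrite mem_cat => /orP[] /mapP[k _ ->].
  exists (z + unit_vec k) => [th|k']; last by rewrite shiftE; case: eqP => _; lia.
  by rewrite /bsum big_seq1 /pdiff /= -[- _]Z2N opprK addrC.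
exists (z - unit_vec k) => [th|k'].
  by rewrite /bsum big_seq1 /pdiff /= subrK -[- _]Z2N opprK.
by rewrite -[unit_vec k]mulr1n unshiftE; case: eqP => _; lia.
Qed.

Lemma star_edgesE z (a : oriented (edge m)) :
  (esrc a == z) || (etgt a == z) -> a.2 \in star_edges z.
Proof.
rewrite /esrc /etgt mem_cat; case: a => -[] [x k] /= /orP[]/eqP <-;
  apply/orP; ((by left; apply/mapP; exists k; rewrite ?mem_enum)
    || (by right; apply/mapP; exists k; rewrite ?mem_enum ?addrK)).
Qed.

Lemma size_star_edges z : size (star_edges z) = m.*2.
Proof. by rewrite size_cat !size_map -enumT size_enum_ord addnn. Qed.

Section Box.
Variables (N : nat) (beta kappa : R).
Hypothesis beta0 : 0 <= beta.
Hypothesis kappa0 : 0 <= kappa.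
Local Notation E l := (Defs.expectation beta kappa N (line R l)).

Lemma weight_ferromagnetic : ferromagnetic (@forms m N) (weight beta kappa).
Proof. by rewrite weightE; exact: prod_weight_ferromagnetic. Qed.

Lemma expectation_ge0 l : 0 <= E l.
Proof. by rewrite expectationE avg_ge0 //; [exact: weight_ferromagnetic|exact: line_character]. Qed.

Lemma expectation_cat l l' : E l * E l' <= E (l ++ l').
Proof.
rewrite !expectationE; apply: le_trans (griffiths2 (@config_addVV m N) (@formsD m N)
  weight_ferromagnetic (line_character _ _ l) (line_character _ _ l')) _.
by rewrite le_eqVlt; apply/orP; left; apply/eqP; apply: eq_avg => c _; rewrite /obs line_cat.
Qed.

Lemma link_sqr e s phi : link R e s phi * link R e s phi = 1.
Proof. by rewrite /link -repr_Z2D Z2DD repr_Z2_0. Qed.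

Lemma line_sqr l s phi : line R l s phi * line R l s phi = 1.
Proof. by rewrite /line -big_split big1 // => e _; rewrite /= link_sqr. Qed.

Lemma expectation_line1 l : (forall s phi, line R l s phi = 1) -> E l = 1.
Proof.
move=> hl; rewrite expectationE /avg (eq_gsum (f' := weight beta kappa)).
  by rewrite divff // gt_eqF //; case: weight_ferromagnetic.
by move=> c _; rewrite /obs hl mul1r.
Qed.

Lemma expectation_le1 l : E l <= 1.
Proof.
have h := expectation_cat l l; have h0 := expectation_ge0 l.
rewrite (expectation_line1 (l := l ++ l)) in h; last first.
  by move=> s phi; rewrite line_cat line_sqr.
by nra.
Qed.

(** Changes [phi] at [z] and leaves the gauge field fixed, so it is not a gauge transformation: it
    negates the links at [z] and no others. *)
Definition flip z : config m N := (0, [ffun x => ((val x).2 == z)%:R]).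

Lemma ext_flip z (x : oriented (vertex m)) : z \in box m N -> ext (flip z).2 x = (x.2 == z)%:R.
Proof.
move=> hz; have [h|h] := boolP (x \in C0 m N); first by rewrite ext_finfun.
by rewrite ext_out //; case: eqP => // e; move: h; rewrite mem_C0 e hz.
Qed.

(** The flip at [z] negates the line and fixes all factors except those of edges at [z], so only
    these are expanded. The factor 2 arises because [C1] holds each edge in both orientations. *)
Lemma expectation_odd_step l z y : z \in box m N -> ends l z y -> z != y ->
  E l <= (sh kappa / ch kappa) *+ 2 * \sum_(e <- star_edges z) E (l ++ [:: e]).
Proof.
move=> hz lzy zy; have a0 := ch_gt0 kappa; have /andP[b0 ba] := sh_ch kappa0.
have t0 : 0 <= sh kappa / ch kappa by rewrite divr_ge0 ?(ltW a0).
pose touch (a : oriented (edge m)) := (esrc a == z) || (etgt a == z).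
pose s := [seq a <- enum_fset (C1 m N) | touch a].
pose s' := [seq a <- enum_fset (C1 m N) | predC touch a].
pose w0 c := @prod_weight R m N beta kappa (C2 m N) s' c.
have olink_flip a : ~~ touch a -> olink R a (flip z) = 1.
  rewrite negb_or => /andP[h1 h2]; rewrite /olink /d0 !ext_flip //= (negPf h1) (negPf h2).
  by rewrite ext0 !subr0 repr_Z2_0.
have plaq_flip p : plaq R p (flip z) = 1.
  by case: p => [[x i] j]; rewrite /plaq /d1 !big_cons big_nil !ext0 !addr0 repr_Z2_0.
have w0_flip c : w0 (c + flip z) = w0 c.
  rewrite /w0 /prod_weight; congr (1 * _ * _).
    by apply: eq_bigr => p _; rewrite (plaq_character R N p).2 plaq_flip mulr1.
  rewrite big_seq [RHS]big_seq; apply: eq_bigr => a; rewrite mem_filter => /andP[/olink_flip h _].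
  by rewrite (olink_character R N a).2 h mulr1.
have flipG : flip z \in @forms m N.
  by apply/formsP; split=> x; rewrite ?ext0 // !ext_flip.
have [_ w0P _] := @prod_weight_ferromagnetic R m N _ _ (C2 m N) s' beta0 kappa0.
have psi1 : obs (line R l) (flip z) = -1.
  rewrite /obs /line; transitivity (repr_Z2 R (bsum l (fun x => (x == z)%:R))).
    rewrite (big_morph (repr_Z2 R) (@repr_Z2D R) (repr_Z2_0 R)).
    apply: eq_bigr => e _; rewrite /link /d0 /etgt /esrc !ext_flip //= ext0 sub0r Z2N.
    by rewrite /pdiff !Z2N.
  rewrite lzy eqxx [y == z]eq_sym (negPf zy) addr0 /repr_Z2 /=.
  by rewrite expr1.
have weq c : weight beta kappa c = w0 c * \prod_(a <- s) (ch kappa + sh kappa * olink R a c).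
  rewrite weightE /w0 /prod_weight -[RHS]mulrA; congr (_ * _).
  by rewrite /s /s' !big_filter (bigID touch) mulrC.
have [W0 _ _] := weight_ferromagnetic.
have := odd_step (@config_addVV m N) (@formsD m N) s a0 b0 (olink_character R N) w0P
  (line_character R N l) flipG psi1 w0_flip.
rewrite (eq_gsum (f' := fun c => obs (line R l) c * weight beta kappa c)); last first.
  by move=> c _; rewrite weq.
under eq_bigr => a _.
  rewrite (eq_gsum (f' := fun c => obs (line R (l ++ [:: a.2])) c * weight beta kappa c)).
    over.
  by move=> c cG; rewrite weq /obs line_cat olinkE.
rewrite -ler_pdivlMl // mulrA [_^-1 * _]mulrC => step.
rewrite [leLHS]expectationE /avg.
apply: le_trans (ler_wpM2r (ltW _) step) _; first by rewrite invr_gt0.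
rewrite -mulrA mulr_suml mulrnAl -mulrnAr ler_wpM2l //.
rewrite (eq_bigr (fun a => E (l ++ [:: a.2]))); last by move=> a _; rewrite expectationE.
apply: le_trans (_ : \sum_(a <- [seq (b, e) | b <- [:: true; false], e <- star_edges z])
   E (l ++ [:: a.2]) <= _).
  apply: ler_sum_subset => [||a]; last exact: expectation_ge0.
    by apply: filter_uniq; exact: fset_uniq.
  move=> a; rewrite mem_filter => /andP[/star_edgesE ha _].
  by apply/allpairsP; exists a; split=> //; [case: (a.1)|case: (a)].
by rewrite big_allpairs_dep !big_cons big_nil /= addr0 mulr2n.
Qed.

End Box.
End OddStep.

(** * Infinite volume and decay of open lines *)

Section InfiniteVolume.
Variables (R : realType) (m : nat).
Hypothesis hm : (3 <= m)%N.
Variables (beta kappa : R).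
Hypothesis beta0 : 0 <= beta.
Hypothesis kappa0 : 0 <= kappa.
Implicit Types (x y z : vertex m) (l : seq (edge m)) (e : edge m).
Local Notation E := (fun N l => Defs.expectation beta kappa N (line R l)).
Local Notation M l := (mean beta kappa (line R l)).

Lemma mem_large_box x : exists N, x \in box m N.
Proof.
exists (\max_k absz (x 0%R k)); rewrite -cube0; apply/forallP => k.
by rewrite mxE subr0 -abszE lez_nat; apply: leq_bigmax.
Qed.

Lemma edges_large_box l : exists N, forall N', (N <= N')%N -> all (edge_in N') l.
Proof.
elim: l => [|e l [N hN]]; first by exists 0%N.
have [N1 h1] := mem_large_box e.1; have [N2 h2] := mem_large_box (e.1 + unit_vec e.2).
exists (maxn N (maxn N1 N2)) => N'; rewrite !geq_max => /and3P[h hN1 hN2] /=.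
by rewrite hN // andbT /edge_in (box_sub hN1 h1) (box_sub hN2 h2).
Qed.

(** By Griffiths the averages increase with the box once it contains the line, and they are at most
    1. *)
Lemma expectation_cvg l : E ^~ l @ \oo --> M l.
Proof.
have [N0 hN0] := edges_large_box l.
apply: (@near_nondecreasing_is_cvgn _ _ 1); last by near=> N; exact: expectation_le1.
exists N0 => //= N hN N' NN'; apply: expectation_mono => //; exact: hN0.
Unshelve. all: by end_near. Qed.

Lemma mean_ge0 l : 0 <= M l.
Proof.
by apply: (cvgr_to_ge (@expectation_cvg l)); near=> N; exact: expectation_ge0.
Unshelve. all: by end_near. Qed.

Lemma mean_le1 l : M l <= 1.
Proof.
by apply: (cvgr_to_le (@expectation_cvg l)); near=> N; exact: expectation_le1.
Unshelve. all: by end_near. Qed.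

Lemma mean_cat l l' : M l * M l' <= M (l ++ l').
Proof.
apply: (ler_cvg_to (cvgM (@expectation_cvg l) (@expectation_cvg l')) (@expectation_cvg _)).
by near=> N; exact: expectation_cat.
Unshelve. all: by end_near. Qed.

Lemma mean_odd_step l z y : ends l z y -> z != y ->
  M l <= (sh kappa / ch kappa) *+ 2 * \sum_(e <- star_edges z) M (l ++ [:: e]).
Proof.
move=> lzy zy; have [N0 hN0] := mem_large_box z.
have sum_cvg (s : seq (edge m)) : (fun N => \sum_(e <- s) E N (l ++ [:: e])) @ \oo -->
    \sum_(e <- s) M (l ++ [:: e]).
  elim: s => [|e s IHs].
    rewrite big_nil; have -> : (fun N => \sum_(e <- [::]) E N (l ++ [:: e])) = cst 0.
      by apply/funext => N; rewrite big_nil.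
    exact: cvg_cst.
  rewrite big_cons; have -> : (fun N => \sum_(j <- e :: s) E N (l ++ [:: j])) =
      (fun N => E N (l ++ [:: e]) + \sum_(j <- s) E N (l ++ [:: j])).
    by apply/funext => N; rewrite big_cons.
  exact: cvgD (@expectation_cvg _) IHs.
apply: (ler_cvg_to (@expectation_cvg l)
  (cvgM (cvg_cst (sh kappa / ch kappa *+ 2)) (sum_cvg (star_edges z)))).
exists N0 => //= N hN; apply: expectation_odd_step lzy zy => //; exact: box_sub hN0.
Qed.

Hypothesis beta_large : 3 * 9 ^+ m * (1 - (sh beta / ch beta) ^+ size (dirs m)) <= 1.

Lemma mean_closed_ge l : (forall th, bsum l th = 0) -> (1 / 2) ^+ size l <= M l.
Proof.
move=> lcl; have [N0 hN0] := edges_large_box l.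
apply: (cvgr_to_ge (@expectation_cvg l)); exists (3 * N0).+2 => //= N hN.
apply: (closed_line_ge hm beta0 kappa0 beta_large (leqnn (3 * N0)) hN) => // e el.
by have /allP/(_ _ el)/andP[] := hN0 _ (leqnn N0).
Qed.

Hypothesis kappa_small : (sh kappa / ch kappa) * (8 * m%:R) <= 1 / 2.
Local Notation q := ((sh kappa / ch kappa) * (8 * m%:R)).

Lemma tanh_ge0 : 0 <= sh kappa / ch kappa.
Proof. by have /andP[b0 _] := sh_ch kappa0; rewrite divr_ge0 // ltW // ch_gt0. Qed.

Lemma q_ge0 : 0 <= q.
Proof. by rewrite mulr_ge0 ?tanh_ge0 // mulr_ge0. Qed.

(* Iterating the odd step moves the endpoint [z] along all walks; those that
   reach [y] are controlled by [X 2^|l|], the others contribute [(q / 2)^n]. *)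
Lemma walk_decay (f : seq (edge m) -> R) x y i (X : R) :
  0 <= X -> (forall l, f l <= 1) ->
  (forall l z, ends l x z -> z != y ->
     f l <= (sh kappa / ch kappa) *+ 2 * \sum_(e <- star_edges z) f (l ++ [:: e])) ->
  (forall l, ends l x y -> f l <= X * 2 ^+ size l) ->
  f [::] <= X * q ^+ absz (x 0 i - y 0 i)%R.
Proof.
move=> X0 f1 fstep fend; have q0 := q_ge0.
have q1 : q <= 1 by apply: le_trans kappa_small _; lra.
pose d (z : vertex m) : nat := absz (z 0 i - y 0 i)%R.
have main n : forall l z, ends l x z ->
    f l <= X * 2 ^+ size l * q ^+ d z + (q / 2) ^+ n.
  elim: n => [|n IHn] l z lxz.
    by rewrite expr0 -[leLHS]add0r lerD // ?f1 // !mulr_ge0 ?exprn_ge0.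
  have [zy|zy] := eqVneq z y.
    rewrite -[leLHS]addr0 lerD //; last by rewrite exprn_ge0 // divr_ge0.
    by rewrite zy /d subrr expr0 mulr1; apply: fend; rewrite -zy.
  apply: le_trans (fstep l z lxz zy) _.
  apply: le_trans (_ : sh kappa / ch kappa *+ 2 * (\sum_(e <- star_edges z)
     (X * 2 ^+ (size l).+1 * q ^+ (d z).-1 + (q / 2) ^+ n)) <= _).
    rewrite ler_wpM2l ?mulrn_wge0 ?tanh_ge0 // big_seq [leRHS]big_seq.
    apply: ler_sum => e /star_edgesP[z' ezz' hz'].
    have lz' : ends (l ++ [:: e]) x z'.
      move=> th; rewrite /bsum big_cat /= -!/(bsum _ _) lxz ezz'.
      by rewrite -[RHS]add0r -(Z2DD (th z)); ring.
    apply: le_trans (IHn _ _ lz') _; rewrite lerD2r size_cat addn1 ler_wpM2l //.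
      by rewrite mulr_ge0 ?exprn_ge0.
    by apply: ler_wiXn2l => //; have := hz' i; rewrite /d; lia.
  rewrite big_const_seq count_predT iter_addr_0 size_star_edges -[X in _ * X]mulr_natl.
  rewrite -muln2 natrM exprS.
  (* The 2m edges at [z], the factor 2 tanh kappa and the doubling of 2^|l| make q = 8 m tanh kappa.
     The remainder has no doubling and gains q / 2. *)
  have -> : sh kappa / ch kappa *+ 2 * (m%:R * 2 * (X * (2 * 2 ^+ size l) * q ^+ (d z).-1
     + (q / 2) ^+ n)) = X * 2 ^+ size l * (q * q ^+ (d z).-1) + (q / 2) * (q / 2) ^+ n.
    rewrite -mulr_natl; move: ((q / 2) ^+ n) (q ^+ (d z).-1) (2 ^+ size l) => r Q s.
    by move: (sh kappa / ch kappa) (m%:R : R) => t a; field.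
  rewrite [(q / 2) ^+ n.+1]exprS lerD2r ler_wpM2l ?mulr_ge0 ?exprn_ge0 //.
  by rewrite -exprS ler_wiXn2l //; lia.
have fnil n : f [::] <= X * q ^+ d x + (q / 2) ^+ n.
  have := main n [::] x; rewrite expr0 mulr1; apply => th.
  by rewrite /bsum big_nil Z2DD.
have q2 : `|q / 2| < 1 by rewrite ger0_norm ?divr_ge0 //; move: q1; lra.
have hcvg : (fun n => X * q ^+ d x + (q / 2) ^+ n) @ \oo --> X * q ^+ d x.
  by rewrite -[X in _ --> X]addr0; exact: cvgD (cvg_cst _) (cvg_expr q2).
by apply: (cvgr_to_ge hcvg); near=> n; exact: fnil.
Unshelve. all: by end_near. Qed.

Lemma eq_mean_line l l' : (forall s phi, line R l s phi = line R l' s phi) -> M l = M l'.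
Proof.
by move=> h; congr (mean beta kappa _); apply/funext => s; apply/funext => phi.
Qed.

Lemma open_lines_decay l1 l2 x y i : ends l1 x y -> ends l2 x y ->
  M l1 * M l2 <= M (l1 ++ l2) * (1 / 2) ^+ absz (x 0 i - y 0 i)%R.
Proof.
move=> h1 h2; set d := absz _.
have qd : q ^+ d <= (1 / 2) ^+ d by rewrite lerXn2r ?nnegrE ?q_ge0 ?divr_ge0.
have qd1 : q ^+ d <= 1.
  by rewrite exprn_ile1 ?q_ge0 //; apply: le_trans kappa_small _; lra.
have qd0 : 0 <= q ^+ d by rewrite exprn_ge0 ?q_ge0.
have f1 l l' : M l * M l' <= 1.
  by apply: mulr_ile1; rewrite ?mean_ge0 ?mean_le1.
have hstep l w z : ends l x y -> ends w x z -> z != y -> M (l ++ w) <=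
    (sh kappa / ch kappa) *+ 2 * \sum_(e <- star_edges z) M (l ++ w ++ [:: e]).
  move=> lxy wxz zy; under eq_bigr => e _ do rewrite catA.
  exact: mean_odd_step (ends_cat lxy wxz) zy.
have base w1 w2 : ends w1 x y -> ends w2 x y ->
    M (l1 ++ w1) * M (l2 ++ w2) <= M (l1 ++ l2) * 2 ^+ size w2 * 2 ^+ size w1.
  move=> hw1 hw2; apply: le_trans (mean_cat _ _) _.
  have hw : (1 / 2) ^+ size (w1 ++ w2) <= M (w1 ++ w2).
    by apply: mean_closed_ge => th; rewrite /bsum big_cat /= -!/(bsum _ _) hw1 hw2 Z2DD.
  (* Appending [w1 ++ w2] cancels both walks, since links square to 1; the lower bound for this
     closed line costs the factor 2^(|w1| + |w2|). *)
  have := mean_cat ((l1 ++ w1) ++ l2 ++ w2) (w1 ++ w2).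
  rewrite [leRHS](@eq_mean_line _ (l1 ++ l2)); last first.
    move=> s phi; rewrite !line_cat; have := line_sqr R w1 s phi; have := line_sqr R w2 s phi.
    move: (line R l1 s phi) (line R l2 s phi) (line R w1 s phi) (line R w2 s phi) => a b c e e2 c2.
    by transitivity (a * b * (c * c) * (e * e)); [ring|rewrite e2 c2 !mulr1].
  move=> h; have {h} := le_trans (ler_wpM2l (mean_ge0 _) hw) h.
  rewrite size_cat expr_div_n expr1n -ler_pdivlMr ?divr_gt0 ?exprn_gt0 //.
  by rewrite invf_div divr1 exprD mulrA [_ * _ ^+ size w2]mulrC mulrAC [_ * M _]mulrC -mulrA mulrCA mulrA.
(* The walks attached to [l1] are summed with [w2] fixed; those attached to [l2] are summed
   afterwards. *)
have step1 w2 : ends w2 x y -> M l1 * M (l2 ++ w2) <= M (l1 ++ l2) * 2 ^+ size w2 * q ^+ d.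
  move=> hw2; have := @walk_decay (fun w => M (l1 ++ w) * M (l2 ++ w2)) x y i
    (M (l1 ++ l2) * 2 ^+ size w2); rewrite cats0; apply.
  - by rewrite mulr_ge0 ?mean_ge0 ?exprn_ge0.
  - by move=> w; exact: f1.
  - move=> w z hw zy; apply: le_trans (ler_wpM2r (mean_ge0 _) (hstep _ _ _ h1 hw zy)) _.
    by rewrite -mulrA mulr_suml.
  - by move=> w hw; exact: base.
have := @walk_decay (fun w => M l1 * M (l2 ++ w)) x y i (M (l1 ++ l2) * q ^+ d).
rewrite cats0 => h; apply: le_trans (h _ _ _ _) _.
- by rewrite mulr_ge0 ?mean_ge0.
- by move=> w; exact: f1.
- move=> w z hw zy; apply: le_trans (ler_wpM2l (mean_ge0 _) (hstep _ _ _ h2 hw zy)) _.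
  by rewrite mulrCA mulr_sumr.
- by move=> w hw; rewrite mulrAC; exact: step1.
(* Each of the two sums gives a factor q^d; one of them is bounded by 1. *)
rewrite -mulrA ler_wpM2l ?mean_ge0 // -/d.
by apply: le_trans (ler_piMr qd0 qd1) qd.
Qed.

End InfiniteVolume.

(** * The rectangles *)

Section ChainSums.
Variables (K : choiceType) (W : zmodType) (h : K -> W).
Implicit Types (c : {freeg K / int}).

(** The additive extension of [h] to chains. Both [eval_chain] and [boundary] have this form, so one
    lemma gives the multiplicativity of Wilson lines. *)
Definition chain_sum c : W := \sum_(x <- dom c) h x *~ coeff x c.

Lemma chain_sum_wide c s : uniq s -> {subset dom c <= s} ->
  chain_sum c = \sum_(x <- s) h x *~ coeff x c.
Proof.
move=> us cs; rewrite [RHS](bigID (mem (dom c))) /= [X in _ + X]big1 ?addr0 => [|x].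
  rewrite -big_filter; apply: perm_big; apply: uniq_perm; rewrite ?uniq_dom ?filter_uniq //.
  by move=> x; rewrite mem_filter; case: (boolP (x \in dom c)) => //= /cs ->.
by move=> /coeff_outdom ->.
Qed.

Lemma chain_sumD c c' : chain_sum (c + c') = chain_sum c + chain_sum c'.
Proof.
pose s := undup (dom c ++ dom c').
have us : uniq s by exact: undup_uniq.
rewrite !(@chain_sum_wide _ s) //; try by move=> x hx; rewrite mem_undup mem_cat hx ?orbT.
  by rewrite -big_split; apply: eq_bigr => x _; rewrite coeffD mulrzDr.
by move=> x /domD_subset; rewrite mem_undup.
Qed.

Lemma chain_sumN c : chain_sum (- c) = - chain_sum c.
Proof.
by apply/eqP; rewrite -addr_eq0 -chain_sumD addNr /chain_sum dom0 big_nil.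
Qed.

Lemma chain_sumU x : chain_sum << x >> = h x.
Proof. by rewrite /chain_sum domU1 big_seq1 coeffU eqxx mulr1. Qed.

End ChainSums.

Section WilsonLines.
Variables (R : realType) (m : nat).
Implicit Types (c : {freeg (edge m) / int}) (x : vertex m) (i j k : 'I_m).
Implicit Types (s : oriented (edge m) -> 'Z_2) (phi : oriented (vertex m) -> 'Z_2).

Lemma boundaryE c :
  boundary c = chain_sum (fun e => << etgt (false, e) >> - << esrc (false, e) >>) c.
Proof. by apply: eq_bigr => e _; rewrite -{1}[coeff e c]intz scaler_int. Qed.

Lemma wilsonD c c' s phi : wilson R (c + c') s phi = wilson R c s phi * wilson R c' s phi.
Proof.
rewrite /wilson -repr_Z2D !boundaryE !chain_sumD.
rewrite -/(eval_chain _ _) ![eval_chain _ (_ + _)]chain_sumD.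
by congr (repr_Z2 R _); rewrite /eval_chain /chain_sum; ring.
Qed.

Lemma wilsonN c s phi : wilson R (- c) s phi = wilson R c s phi.
Proof.
rewrite /wilson !boundaryE chain_sumN ![eval_chain _ (- _)]chain_sumN.
by rewrite opprK -[X in _ = repr_Z2 R X]Z2N opprB addrC.
Qed.

Lemma wilsonU e s phi : wilson R << e >> s phi = link R e s phi.
Proof.
rewrite /wilson /link boundaryE chain_sumU [eval_chain s _]chain_sumU.
by rewrite [eval_chain phi _]chain_sumD chain_sumN !chain_sumU.
Qed.

Lemma wilson0 s phi : wilson R 0 s phi = 1.
Proof.
by rewrite /wilson /boundary /eval_chain !dom0 !big_nil dom0 big_nil subr0 repr_Z2_0.
Qed.

Definition segment_edges x k (n : nat) : seq (edge m) :=
  [seq (x + unit_vec k *+ l, k) | l <- iota 0 n].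

Lemma wilson_segment x k n s phi :
  wilson R (segment x k n) s phi = line R (segment_edges x k n) s phi.
Proof.
rewrite /segment /line /segment_edges big_map -(big_mkord xpredT (fun l => << (x + unit_vec k *+ l, k) >>)).
rewrite /index_iota subn0; elim: (iota 0 n) => [|l t IHt]; first by rewrite !big_nil wilson0.
by rewrite !big_cons wilsonD IHt wilsonU.
Qed.

Lemma bsum_cat l l' th : @bsum m (l ++ l') th = bsum l th + bsum l' th.
Proof. exact: big_cat. Qed.

Lemma bsum_segment x k n th :
  bsum (segment_edges x k n) th = th (x + unit_vec k *+ n) + th x.
Proof.
rewrite /bsum /segment_edges big_map; elim: n => [|n IHn].
  by rewrite big_nil mulr0n addr0 Z2DD.
rewrite -[n.+1]addn1 iotaD big_cat /= IHn add0n big_seq1 /pdiff /= addn1.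
have -> : x + unit_vec k *+ n.+1 = x + unit_vec k *+ n + unit_vec k by rewrite mulrSr addrA.
by ring.
Qed.

Section Rectangle.
Variables (i j : 'I_m) (T r : nat).

Definition gamma1_edges :=
  segment_edges 0 j r ++ segment_edges 0 i T ++ segment_edges (unit_vec i *+ T) j r.

Definition rectangle_edges :=
  segment_edges 0 i T ++ segment_edges (unit_vec i *+ T) j r.*2 ++
  segment_edges (unit_vec j *+ r.*2) i T ++ segment_edges 0 j r.*2.

Lemma wilson_gamma1 s phi : wilson R (gamma1 i j T r) s phi = line R gamma1_edges s phi.
Proof. by rewrite /gamma1 !wilsonD wilsonN !wilson_segment !line_cat mulrA. Qed.

Lemma wilson_rectangle s phi :
  wilson R (rectangle i j T r.*2) s phi = line R rectangle_edges s phi.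
Proof. by rewrite /rectangle !wilsonD !wilsonN !wilson_segment !line_cat !mulrA. Qed.

(** Modulo 2 the difference of chains becomes concatenation; repeated edges cancel in the
    product. *)
Lemma wilson_gamma2 s phi :
  wilson R (gamma2 i j T r) s phi = line R (rectangle_edges ++ gamma1_edges) s phi.
Proof. by rewrite /gamma2 wilsonD wilsonN wilson_rectangle wilson_gamma1 line_cat. Qed.

Local Notation x := (unit_vec j *+ r).
Local Notation y := (unit_vec i *+ T + unit_vec j *+ r).

Lemma ends_gamma1 : ends gamma1_edges x y.
Proof.
move=> th; rewrite !bsum_cat !bsum_segment !add0r.
set a := th x; set b := th 0; set c := th (_ *+ T); set d := th y.
transitivity (a + d + (b + b) + (c + c)); first by ring.
by rewrite !Z2DD !addr0.
Qed.

Lemma ends_gamma2 : ends (rectangle_edges ++ gamma1_edges) x y.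
Proof.
move=> th; rewrite bsum_cat ends_gamma1 !bsum_cat !bsum_segment !add0r.
rewrite [unit_vec j *+ _ + _]addrC.
set a := th (unit_vec i *+ T); set b := th 0; set c := th (_ *+ r.*2); set d := th (_ + _ *+ r.*2).
transitivity (th x + th y + (a + a) + (b + b) + (c + c) + (d + d)); first by ring.
by rewrite !Z2DD !addr0.
Qed.

End Rectangle.
End WilsonLines.

(** * Elementary bounds on tanh *)

Section Constants.
Variable R : realType.

Lemma one_sub_exp_le (t : R) k : 0 <= t <= 1 -> 1 - t ^+ k <= k%:R * (1 - t).
Proof.
move=> /andP[t0 t1]; elim: k => [|k IHk]; first by rewrite expr0 subrr mul0r.
have h0 := exprn_ge0 k t0; have h1 := exprn_ile1 k t0 t1.
rewrite exprS -addn1 natrD; nra.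
Qed.

(** Here 1 - tanh b = 2 / (exp(2b) + 1), and exp(2b) >= 1 + 2b. *)
Lemma one_sub_tanh_le (b : R) : 0 < b -> 1 - sh b / ch b <= b^-1.
Proof.
move=> b0; have c0 := ch_gt0 b.
rewrite -[X in X - _](divff (lt0r_neq0 c0)) -mulrBl ler_pdivrMr // ler_pdivlMl //.
have h := expR_ge1Dx (2 * b); have e0 := expR_gt0 (- b).
have : expR b = expR (2 * b) * expR (- b) by rewrite -expRD; congr expR; ring.
rewrite /ch /sh => ->; nra.
Qed.

Lemma tanh_le (k : R) : 0 <= k -> sh k / ch k <= 2 * k.
Proof.
move=> k0; have c0 := ch_gt0 k; rewrite ler_pdivrMr //.
have h := expR_ge1Dx (- (2 * k)); have e0 := expR_gt0 k; have e1 := expR_gt0 (- k).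
have : expR (- k) = expR (- (2 * k)) * expR k by rewrite -expRD; congr expR; ring.
rewrite /ch /sh => e; nra.
Qed.

End Constants.

(** * Choice of the constants and limit of the ratio *)

Theorem theorem1p3 (R : realType) (m : nat) (hm : (3 <= m)%N) :
  exists beta_star kappa_star : R, 0 < beta_star /\ 0 < kappa_star /\
    forall beta kappa : R, beta_star < beta -> 0 < kappa -> kappa < kappa_star ->
      exists rho : R,
        (forall (i j : 'I_m) (r T : nat -> nat), i != j ->
           (forall n, (0 < r n)%N) -> (forall n, (0 < T n)%N) ->
           (forall n k, (n < k)%N -> (r n < r k)%N) ->
           (forall n k, (n < k)%N -> (T n < T k)%N) ->
           rho_ratio beta kappa (gamma1 i j (T n) (r n)) (gamma2 i j (T n) (r n))
             @[n --> \oo] --> rho)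
        /\ rho = 0.
Proof.
have m0 : (0 : R) < m%:R by rewrite ltr0n; lia.
(* Since 1 - tanh(beta)^k <= k / beta with [k = size (dirs m)] at most [m ^ 2], [bs] secures the
   Peierls condition. Since tanh kappa <= 2 kappa, [ks] gives 8 m tanh kappa <= 16 m ks = 1/2. *)
pose bs : R := 3 * 9 ^+ m * (m ^ 2)%:R; pose ks : R := (32 * m%:R)^-1.
have bs0 : 0 < bs by rewrite !mulr_gt0 ?exprn_gt0 ?ltr0n ?expn_gt0 //; lia.
have ks0 : 0 < ks by rewrite invr_gt0 mulr_gt0.
exists bs, ks; split=> //; split=> // beta kappa hb hk0 hk.
have b0 : 0 < beta by exact: lt_trans hb.
have blarge : 3 * 9 ^+ m * (1 - (sh beta / ch beta) ^+ size (dirs m)) <= 1.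
  have /andP[s0 s1] := sh_ch (ltW b0).
  have t01 : 0 <= sh beta / ch beta <= 1.
    by rewrite divr_ge0 ?(ltW (ch_gt0 _)) // ler_pdivrMr ?ch_gt0 // mul1r.
  apply: le_trans (_ : 3 * 9 ^+ m * ((m ^ 2)%:R * beta^-1) <= _).
    rewrite ler_wpM2l ?mulr_ge0 ?exprn_ge0 //.
    apply: le_trans (one_sub_exp_le _ t01) _.
    by rewrite ler_pM ?subr_ge0 ?ler_nat ?size_dirs ?one_sub_tanh_le //; case/andP: t01.
  by rewrite mulrA -/bs ler_pdivrMr // mul1r ltW.
have ksmall : (sh kappa / ch kappa) * (8 * m%:R) <= 1 / 2.
  apply: le_trans (_ : 2 * ks * (8 * m%:R) <= _).
    rewrite ler_wpM2r ?mulr_ge0 //; apply: le_trans (tanh_le (ltW hk0)) _.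
    by rewrite ler_wpM2l // ltW.
  by rewrite /ks le_eqVlt; apply/orP; left; apply/eqP; field; lra.
exists 0; split=> // i j r T ij _ _ _ Tinc.
have nT n : (n <= T n)%N.
  by elim: n => // n IHn; apply: leq_ltn_trans IHn (Tinc _ _ _).
pose e1 n := gamma1_edges i j (T n) (r n).
pose e2 n := rectangle_edges i j (T n) (r n) ++ e1 n.
have rhoE n : rho_ratio beta kappa (gamma1 i j (T n) (r n)) (gamma2 i j (T n) (r n)) =
    mean beta kappa (line R (e1 n)) * mean beta kappa (line R (e2 n))
      / mean beta kappa (line R (e1 n ++ e2 n)).
  rewrite /rho_ratio.
  have -> : wilson R (gamma1 i j (T n) (r n)) = line R (e1 n).
    by do 2!apply/funext => ?; exact: wilson_gamma1.
  have -> : wilson R (gamma2 i j (T n) (r n)) = line R (e2 n).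
    by do 2!apply/funext => ?; exact: wilson_gamma2.
  have -> // : wilson R (gamma1 i j (T n) (r n) + gamma2 i j (T n) (r n)) =
    line R (e1 n ++ e2 n).
  by do 2!apply/funext => ?; rewrite wilsonD wilson_gamma1 wilson_gamma2 [RHS]line_cat.
have half : `|1 / 2 : R| < 1 by rewrite ger0_norm; lra.
(* The ratio lies between 0 and 2^(-n). *)
apply: (squeeze_cvgr _ (cvg_cst 0) (cvg_expr half)); near=> n.
rewrite rhoE; have E1 := ends_gamma1 i j (T n) (r n); have E2 := ends_gamma2 i j (T n) (r n).
have den : 0 < mean beta kappa (line R (e1 n ++ e2 n)).
  apply: lt_le_trans (mean_closed_ge hm (ltW b0) (ltW hk0) blarge _).
    by rewrite exprn_gt0 // divr_gt0.
  by move=> th; rewrite bsum_cat E1 E2 Z2DD.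
rewrite divr_ge0 ?mulr_ge0 ?mean_ge0 ?(ltW b0) ?(ltW hk0) //= ler_pdivrMr // [leRHS]mulrC.
apply: le_trans (open_lines_decay hm (ltW b0) (ltW hk0) blarge ksmall i E1 E2) _.
rewrite ler_wpM2l ?(ltW den) // ler_wiXn2l //; first lra.
(* The common endpoints of the two halves differ by [T n >= n] in direction [i]. *)
apply: leq_trans (nT n) _; rewrite !mxE !mulmxnE !mxE !eqxx (negPf ij) /=.
rewrite !mul0rn addr0 sub0r natz abszN; lia.
Unshelve. all: by end_near. Qed.
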